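(* Let $R$ be a nonzero ring. Then: (1) $R_R$ is indecomposable if and only if $(\mathrm{RCP}(R),\le)$ has exactly two minimal elements. (2) The following assertions are equivalent: (a) $R$ is local; (b) every right coprime pair is trivial; (c) the following two conditions are satisfied: (i) $\mathrm{RCP}(R)$ has exactly two minimal elements, and (ii) for each $\langle a,b\rangle\in\mathrm{RCP}(R)$ there exists a minimal right coprime pair $\langle c,d\rangle$ such that $\langle c,d\rangle\le\langle a,b\rangle$. (3) $R$ is left perfect if and only if $R$ has the descending chain condition on right coprime pairs (i.e. the poset $\mathrm{RCP}(R)$ satisfies DCC). (4) $R$ is von Neumann regular if and only if every right coprime pair is regular. (5) $R$ is an exchange ring if and only if for every right coprime pair $\langle a,b\rangle$ there exists a minimal right coprime pair $\langle c,d\rangle$ with $\langle c,d\rangle\le\langle a,b\rangle$. (6) $R$ is right quasi-duo if and only if every left coprime pair is a right coprime pair.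
   Context: Rings are associative with identity. $R_R$ denotes $R$ as a right module over itself. A right coprime pair in $R$ is a pair of elements $a,b\in R$ with $aR+bR=R$; a left coprime pair is a pair $a,b\in R$ with $Ra+Rb=R$. Two right coprime pairs $(a,b)$, $(a',b')$ are identified when $aR=a'R$ and $bR=b'R$; $\langle a,b\rangle$ denotes the equivalence class and $\mathrm{RCP}(R)$ the set of all classes. $\mathrm{RCP}(R)$ is partially ordered by $\langle a,b\rangle\le\langle a',b'\rangle$ iff $aR\subseteq a'R$ and $bR\subseteq b'R$. A minimal right coprime pair is a minimal element of the poset $\mathrm{RCP}(R)$. A right coprime pair is trivial if it is of the form $\langle a,u\rangle$ or $\langle u,a\rangle$ with $a\in R$ and $u\in R$ a unit. An element $a\in R$ is regular if $axa=a$ for some $x\in R$; a right coprime pair $\langle a,b\rangle$ is regular if $a$ and $b$ are regular elements (equivalently, $aR$ and $bR$ are direct summands of $R_R$). $R$ is an exchange ring if for any right $R$-module $X$ and decompositions $X=M\oplus N=A\oplus B$ with $M\cong R_R$, there exist submodules $A'\le A$ and $B'\le B$ such that $X=M\oplus A'\oplus B'$. $R$ is right quasi-duo if every maximal right ideal of $R$ is a left ideal. *)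

(* Defs.v *)
From HB Require Import structures.
From mathcomp Require Import all_boot all_order all_algebra.
From mathcomp Require Import boolp classical_sets.

Set Implicit Arguments.
Unset Strict Implicit.
Unset Printing Implicit Defensive.

Import Order.TTheory GRing.Theory.
Local Open Scope classical_set_scope.
Local Open Scope quotient_scope.
Local Open Scope ring_scope.

(* A left S-module is an lmodType S; a right R-module is an lmodType R^c, where
   R^c is the opposite ring.  Thus R^o is R as a left module over itself, and
   R^c^o is R as a right module over itself: there, r *: x is x * r in R. *)

Section Modules.
Variables (S : nzRingType) (V : lmodType S).
Implicit Types A B C : set V.

Definition submodule A := submod_closed (mem A).

Definition maximal_submodule A :=
  [/\ submodule A, A != setT &
      forall B, submodule B -> A `<=` B -> B = A \/ B = setT].

Definition direct_sum2 A B :=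
  forall x : V, exists! y : V * V, [/\ A y.1, B y.2 & x = y.1 + y.2].

Definition direct_sum3 A B C :=
  forall x : V, exists! y : V * V * V,
    [/\ A y.1.1, B y.1.2, C y.2 & x = y.1.1 + y.1.2 + y.2].

Definition indecomposable :=
  (exists x : V, x != 0) /\
  forall A B, submodule A -> submodule B -> direct_sum2 A B ->
    A = [set 0] \/ B = [set 0].

Definition semisimple :=
  forall A, submodule A -> exists B, submodule B /\ direct_sum2 A B.

(* The submodule A is isomorphic to the module W. *)
Definition isomorphic_to A (W : lmodType S) :=
  exists f : {linear W -> V}, injective f /\ range f = A.

End Modules.

Fact rcp_display : Order.disp_t. Proof. exact: Order.Disp tt tt. Qed.

Section Rings.
Variable R : nzRingType.
Implicit Types a b u : R.

Definition left_ideal (I : set R) := submodule (I : set R^o).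

Definition maximal_left_ideal (I : set R) := maximal_submodule (I : set R^o).
Definition maximal_right_ideal (I : set R) :=
  maximal_submodule (I : set R^c^o).

Definition is_unit u := exists v : R, u * v = 1 /\ v * u = 1.

Definition regular_elt a := exists x : R, a * x * a = a.

Definition local_ring := exists! M : set R, maximal_right_ideal M.

Definition von_neumann_regular := forall a, regular_elt a.

Definition right_quasi_duo :=
  forall M : set R, maximal_right_ideal M -> left_ideal M.

Definition jacobson_radical : set R :=
  \bigcap_(M in [set M : set R | maximal_left_ideal M]) M.

Definition left_T_nilpotent (J : set R) :=
  forall a : nat -> R, (forall i, J (a i)) ->
    exists n, \prod_(0 <= i < n) a i = 0.

(* R / rad R is semisimple and rad R is left T-nilpotent (Bass; Lam, A First
   Course in Noncommutative Rings, Definition 23.18).  The quotient ring is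
   given by a surjective ring morphism with kernel rad R. *)
Definition left_perfect :=
  (exists (S : nzRingType) (f : {rmorphism R -> S}),
     [/\ range f = setT, f @^-1` [set 0] = jacobson_radical &
         semisimple S^o]) /\
  left_T_nilpotent jacobson_radical.

Definition exchange_ring :=
  forall (X : lmodType R^c) (M N A B : set X),
    submodule M -> submodule N -> submodule A -> submodule B ->
    direct_sum2 M N -> direct_sum2 A B -> isomorphic_to M R^c^o ->
    exists A' B' : set X,
      [/\ submodule A', submodule B', A' `<=` A, B' `<=` B &
          direct_sum3 M A' B'].

Definition rprincipal a : set R := [set a * x | x in setT].
Definition lprincipal a : set R := [set x * a | x in setT].

Definition right_coprime a b :=
  [set x + y | x in rprincipal a & y in rprincipal b] = setT.
Definition left_coprime a b :=
  [set x + y | x in lprincipal a & y in lprincipal b] = setT.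

Definition rcpair := {p : R * R | `[< right_coprime p.1 p.2 >]}.

Definition rcpair_le (p q : rcpair) : bool :=
  `[< rprincipal (val p).1 `<=` rprincipal (val q).1 /\
      rprincipal (val p).2 `<=` rprincipal (val q).2 >].

Definition rcpair_eqv (p q : rcpair) : bool :=
  `[< rprincipal (val p).1 = rprincipal (val q).1 /\
      rprincipal (val p).2 = rprincipal (val q).2 >].

Lemma rcpair_eqv_refl : reflexive rcpair_eqv.
Proof. by move=> p; apply/asboolP. Qed.

Lemma rcpair_eqv_sym : symmetric rcpair_eqv.
Proof. by move=> p q; apply/asboolP/asboolP => -[-> ->]. Qed.

Lemma rcpair_eqv_trans : transitive rcpair_eqv.
Proof. by rewrite /rcpair_eqv => q p r /asboolP[-> ->]. Qed.

Canonical rcpair_equiv_rel :=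
  EquivRel rcpair_eqv rcpair_eqv_refl rcpair_eqv_sym rcpair_eqv_trans.

Definition RCP := {eq_quot rcpair_eqv}.

HB.instance Definition _ := Choice.on RCP.
HB.instance Definition _ := EqQuotient.on RCP.

Definition rcp a b (ab : right_coprime a b) : RCP :=
  \pi_RCP (exist (fun p => is_true `[< right_coprime p.1 p.2 >]) (a, b)
            (asboolT ab)).

Definition rcp_le (p q : RCP) : bool := rcpair_le (repr p) (repr q).

Lemma rcp_le_refl : reflexive rcp_le.
Proof. by move=> p; apply/asboolP; split; apply: subset_refl. Qed.

Lemma rcp_le_anti : antisymmetric rcp_le.
Proof.
move=> p q /andP[/asboolP[pq1 pq2] /asboolP[qp1 qp2]].
rewrite -[p]reprK -[q]reprK; apply/eqmodP/asboolP.
by split; apply/seteqP.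
Qed.

Lemma rcp_le_trans : transitive rcp_le.
Proof.
move=> q p r /asboolP[pq1 pq2] /asboolP[qr1 qr2]; apply/asboolP.
by split; [apply: subset_trans pq1 qr1 | apply: subset_trans pq2 qr2].
Qed.

HB.instance Definition _ :=
  Order.Le_isPOrder.Build rcp_display RCP
    rcp_le_refl rcp_le_anti rcp_le_trans.

Definition rcp_trivial (p : RCP) :=
  exists a u, is_unit u /\
    ((exists h : right_coprime a u, p = rcp h) \/
     (exists h : right_coprime u a, p = rcp h)).

Definition rcp_regular (p : RCP) :=
  exists a b (h : right_coprime a b),
    [/\ p = rcp h, regular_elt a & regular_elt b].

Lemma rcp_eqE a b a' b' (h : right_coprime a b) (h' : right_coprime a' b') :
  rcp h = rcp h' <->
  rprincipal a = rprincipal a' /\ rprincipal b = rprincipal b'.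
Proof. by split=> [/eqmodP/asboolP|hh]; last apply/eqmodP/asboolP. Qed.

Lemma rcp_leE a b a' b' (h : right_coprime a b) (h' : right_coprime a' b') :
  (rcp h <= rcp h')%O <->
  rprincipal a `<=` rprincipal a' /\ rprincipal b `<=` rprincipal b'.
Proof.
have reprE x y (k : right_coprime x y) :
  rprincipal (val (repr (rcp k))).1 = rprincipal x /\
  rprincipal (val (repr (rcp k))).2 = rprincipal y.
  by have /eqmodP/asboolP[] := reprK (rcp k).
have [<- <-] := reprE _ _ h; have [<- <-] := reprE _ _ h'.
by split=> [/asboolP|?]; last apply/asboolP.
Qed.

Lemma rcpP (p : RCP) : exists a b (h : right_coprime a b), p = rcp h.
Proof.
elim/quotW: p => -[[a b] /= h]; exists a, b, (asboolW h).
by congr \pi; apply: val_inj.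
Qed.

(* Regularity of a class does not depend on the representatives. *)
Lemma rcp_regularE a b (h : right_coprime a b) :
  rcp_regular (rcp h) <-> regular_elt a /\ regular_elt b.
Proof.
have reg x y : rprincipal x = rprincipal y -> regular_elt y -> regular_elt x.
  move=> xy [z yzy].
  have [s _ xE] : rprincipal y x by rewrite -xy; exists 1; rewrite ?mulr1.
  have [t _ yE] : rprincipal x y by rewrite xy; exists 1; rewrite ?mulr1.
  by exists (t * z); rewrite mulrA yE -xE mulrA yzy.
split=> [[a' [b' [h' [/rcp_eqE[aa' bb'] ra rb]]]]|[ra rb]].
  by split; [apply: reg aa' ra | apply: reg bb' rb].
by exists a, b, h.
Qed.

End Rings.

Section Posets.
Variables (d : Order.disp_t) (T : porderType d).

Definition minimal_elt (p : T) := forall q : T, (q <= p)%O -> q = p.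

Definition exactly_two_minimal_elts :=
  exists p q : T, p != q /\ [set r | minimal_elt r] = [set p; q].

Definition DCC :=
  forall f : nat -> T, (forall n, (f n.+1 <= f n)%O) ->
    exists N, forall n, (N <= n)%N -> f n = f N.

End Posets.

Arguments exactly_two_minimal_elts {d} T.
Arguments DCC {d} T.

(* Main.v *)
(* A right coprime pair is minimal exactly when it is <e, 1 - e> for an
   idempotent e; this settles (1), (2) and the right-hand side of (5), which
   says that every coprime pair a, b admits an idempotent e in aR with 1 - e
   in bR. The exchange property of R yields instead an idempotent in Ra with
   complement in Rb, and the two conditions are equivalent by an explicit
   formula. For (6), a maximal right ideal M that is not a left ideal gives m
   in M and r with rm not in M, hence a left coprime pair inside M.

   For (3), the pairs <a, 1> reduce DCC on RCP(R) to DCC on principal right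
   ideals. This DCC makes rad R left T-nilpotent, and makes R/rad R von
   Neumann regular, then semisimple. Conversely, given elements a_0, a_1,
   ..., the direct limit F of the left modules R -> R -> ... (right
   multiplications by the a_i) is, modulo rad R, a limit of modules of
   bounded length, hence reached at a finite stage. An idempotent lifted
   there propagates to all later stages and cuts F out of them; left
   T-nilpotence kills the complement, so that a_0 ... a_(n-1) R is eventually
   constant. *)
Require Import Defs.
From HB Require Import structures.
From mathcomp Require Import all_boot all_order all_algebra.
From mathcomp Require Import boolp classical_sets ring.

Set Implicit Arguments.
Unset Strict Implicit.
Unset Printing Implicit Defensive.

Import Order.TTheory GRing.Theory.
Local Open Scope classical_set_scope.
Local Open Scope ring_scope.

(** * Submodules and direct sums, elementwise *)

Lemma submoduleP (S : nzRingType) (V : lmodType S) (A : set V) :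
  submodule A <-> A 0 /\ forall s u v, A u -> A v -> A (s *: u + v).
Proof.
split=> [[A0 Alin]|[A0 Alin]]; split; rewrite ?in_setE //.
- by move: A0; rewrite in_setE.
- move=> s u v Au Av; have := Alin s u v.
  by rewrite !in_setE; apply.
- by move=> s u v; rewrite !in_setE; apply: Alin.
Qed.

Section Submodules.
Variables (S : nzRingType) (V : lmodType S).
Implicit Types (A B : set V) (s : S) (u v : V).

Lemma submodule0 A : submodule A -> A 0.
Proof. by case/submoduleP. Qed.

Lemma submoduleZ A s u : submodule A -> A u -> A (s *: u).
Proof. by case/submoduleP=> A0 Al Au; rewrite -[_ *: _]addr0; apply: Al. Qed.

Lemma submoduleD A u v : submodule A -> A u -> A v -> A (u + v).
Proof. by case/submoduleP=> A0 Al Au Av; rewrite -[u]scale1r; apply: Al. Qed.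

Lemma submoduleN A u : submodule A -> A u -> A (- u).
Proof. by move=> sA Au; rewrite -scaleN1r; apply: submoduleZ. Qed.

Lemma submoduleB A u v : submodule A -> A u -> A v -> A (u - v).
Proof. by move=> sA Au Av; apply: submoduleD => //; apply: submoduleN. Qed.

Lemma direct_sum2_capE A B u :
  submodule A -> submodule B -> direct_sum2 A B -> A u -> B u -> u = 0.
Proof.
move=> sA sB AB Au Bu; have [y [_ yuniq]] := AB u.
have E1 : y = (u, 0).
  by apply: yuniq; split; rewrite ?addr0 //; apply: submodule0.
have E2 : y = (0, u).
  by apply: yuniq; split; rewrite ?add0r //; apply: submodule0.
by move: E1; rewrite E2 => -[->].
Qed.

Lemma direct_sum2P A B : submodule A -> submodule B ->
  (forall u, A u -> B u -> u = 0) ->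
  (forall u, exists v w, [/\ A v, B w & u = v + w]) -> direct_sum2 A B.
Proof.
move=> sA sB AB0 ABT u; have [v [w [Av Bw ->]]] := ABT u.
exists (v, w); split=> // -[v' w'] /= [Av' Bw' E].
have vE : v - v' = w' - w.
  by apply/eqP; rewrite subr_eq addrAC eq_sym subr_eq [_ + v']addrC E.
have /subr0_eq vv' : v - v' = 0.
  by apply: AB0; [apply: submoduleB | rewrite vE; apply: submoduleB].
by move: E; rewrite vv' => /addrI ->.
Qed.

End Submodules.

(** * Maximal left ideals *)

Section LeftIdeals.
Variable S : nzRingType.
Implicit Types (A M : set S^o) (x : S).

Lemma maximal_submodule_not1 M : maximal_submodule M -> ~ M (1 : S).
Proof.
move=> [sM /eqP MT _] M1; apply: MT; apply/seteqP; split=> // x _.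
by rewrite -[x]mulr1; apply: (@submoduleZ _ S^o _ x _ sM M1).
Qed.

Lemma exists_maximal_submodule A : submodule A -> ~ A (1 : S) ->
  exists M, maximal_submodule M /\ A `<=` M.
Proof.
move=> sA A1.
(* Zorn's lemma is applied to unions with [A], so that the empty chain, whose union is empty, yields
   the proper ideal [A] itself. *)
pose P := [set X : set S^o | submodule (A `|` X) /\ ~ (A `|` X) (1 : S)].
have [|X [[sX X1] Xmax]] := @Zorn_bigcup S^o P.
  move=> F FP Ftot.
  have UE : (A `|` \bigcup_(X in F) X) 
            = [set x | A x \/ exists2 X, F X & (A `|` X) x].
    apply/seteqP; split=> x [Ax|[X FX Xx]]; try by left.
      by right; exists X => //; right.
    by case: Xx => [Ax|Xx]; [left|right; exists X].
  split; rewrite UE; last by move=> [//|[X /FP[_ X1]]].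
  apply/submoduleP; split; first by left; apply: submodule0.
  move=> s u v uI vI.
  have {}uI : A u \/ exists2 X, F X & (A `|` X) u by [].
  have subA X w : A w -> (A `|` X) w by left.
  have closed X : F X -> (A `|` X) u -> (A `|` X) v ->
      exists2 X, F X & (A `|` X) (s *: u + v).
    move=> FX Xu Xv; exists X => //; have [sX _] := FP _ FX.
    by apply: submoduleD => //; apply: submoduleZ.
  case: uI vI => [Au|[X FX Xu]] [Av|[Y FY Yv]].
  - by left; apply: submoduleD => //; apply: submoduleZ.
  - by right; apply: closed FY _ Yv; left.
  - by right; apply: closed FX Xu _; left.
  - right; have [XY|YX] := Ftot _ _ FX FY.
      by apply: closed FY _ Yv; case: Xu => [|/XY]; [left|right].
    by apply: closed FX Xu _; case: Yv => [|/YX]; [left|right].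
exists (A `|` X); split; last by move=> x; left.
split=> //; first by apply/eqP => XT; apply: X1; rewrite XT.
move=> B sB XB; have [B1|B1] := pselect (B 1).
  right; apply/seteqP; split=> // x _.
  by rewrite -[x]mulr1; apply: (@submoduleZ _ S^o _ x _ sB B1).
left; apply/seteqP; split=> // x Bx; right.
apply: contrapT => nXx; apply: (Xmax B).
  by split=> [|BX]; [move=> y Xy; apply: XB; right | apply/nXx/BX].
have -> : P B = (submodule (A `|` B) /\ ~ (A `|` B) (1 : S)) by [].
suff -> : A `|` B = B by [].
by apply/setUidPr => y Ay; apply: XB; left.
Qed.

Lemma maximal_submodule_add M x : maximal_submodule M -> ~ M x ->
  exists m s, M m /\ 1 = m + s * x.
Proof.
move=> [sM _ Mmax] Mx.
pose B := [set y : S^o | exists m s, M m /\ y = m + s * x].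
have sB : submodule B.
  apply/submoduleP; split.
    by exists 0, 0; rewrite mul0r addr0; split=> //; apply: submodule0.
  move=> s _ _ [m [t [Mm ->]]] [m' [t' [Mm' ->]]].
  exists (s *: m + m'), (s * t + t'); split.
    by apply: submoduleD => //; apply: submoduleZ.
  by rewrite scalerDr mulrDl -mulrA [s *: (_ * _)]/(s * _) addrACA.
have [|BM|BT] := Mmax B sB.
- by move=> y My; exists y, 0; rewrite mul0r addr0.
- case: Mx; rewrite -BM; exists 0, 1; rewrite mul1r add0r.
  by split=> //; apply: submodule0.
- by have [m [s ?]] : B 1 by [rewrite BT]; exists m, s.
Qed.

End LeftIdeals.
(** * Right coprime pairs *)

Section CoprimePairs.
Variable R : nzRingType.
Implicit Types (a b c d e x y z : R) (p q : RCP R).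

Lemma rprincipalP a x : rprincipal a x <-> exists y, x = a * y.
Proof. by split=> [[y _ <-]|[y ->]]; exists y. Qed.

Lemma rprincipal_subP a b :
  rprincipal a `<=` rprincipal b <-> exists x, a = b * x.
Proof.
split=> [ab|[x ->] _ [y _ <-]]; last by exists (x * y); rewrite ?mulrA.
by apply/rprincipalP/ab/rprincipalP; exists 1; rewrite mulr1.
Qed.

Lemma rprincipal_eqP a b : rprincipal a = rprincipal b <->
  (exists x, a = b * x) /\ (exists y, b = a * y).
Proof.
split=> [ab|[/rprincipal_subP ? /rprincipal_subP ?]]; last exact/seteqP.
by split; apply/rprincipal_subP; rewrite ab.
Qed.

Lemma right_coprimeP a b :
  right_coprime a b <-> exists x y, a * x + b * y = 1.
Proof.
split=> [ab|[x [y xy]]].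
  have : setT (1 : R) by []; rewrite -ab => -[_ [x _ <-] [_ [y _ <-]]] E.
  by exists x, y.
apply/seteqP; split=> // z _.
exists (a * (x * z)); first by exists (x * z).
by exists (b * (y * z)); [exists (y * z) | rewrite !mulrA -mulrDl xy mul1r].
Qed.

Lemma idempotent_coprime e : right_coprime e (1 - e).
Proof. by apply/right_coprimeP; exists 1, 1; rewrite !mulr1 addrC subrK. Qed.

Lemma coprime1r a : right_coprime 1 a.
Proof. by apply/right_coprimeP; exists 1, 0; rewrite mulr0 addr0 mulr1. Qed.

Lemma coprime1l a : right_coprime a 1.
Proof. by apply/right_coprimeP; exists 0, 1; rewrite mulr0 add0r mulr1. Qed.

Lemma idempotent_mulNr e : e * e = e -> e * (1 - e) = 0.
Proof. by move=> ee; rewrite mulrBr mulr1 ee subrr. Qed.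

Lemma idempotent_mulNl e : e * e = e -> (1 - e) * e = 0.
Proof. by move=> ee; rewrite mulrBl mul1r ee subrr. Qed.

Lemma idempotent_compl e : e * e = e -> (1 - e) * (1 - e) = 1 - e.
Proof. by move=> ee; rewrite mulrBr mulr1 idempotent_mulNl // subr0. Qed.

(** If a x + b y = 1, then (a x, 1 - a x) lies below (a, b), so a minimal class has the form (c, 1 -
    c), and minimality forces c to be idempotent. Conversely, if a is in eR, b in (1 - e)R and a z +
    b w = 1, multiplying by e gives e = a z, and likewise 1 - e = b w. *)
Lemma minimal_rcpP p : minimal_elt p <->
  exists e, e * e = e /\ p = rcp (idempotent_coprime e).
Proof.
split=> [|[e [ee ->]] q].
  have [a [b [ab ->]]] := rcpP p.
  have /right_coprimeP[x [y xy]] := ab => min_ab.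
  have E : b * y = 1 - a * x by rewrite -xy addrC addKr.
  have cd := idempotent_coprime (a * x).
  have Ecd : rcp cd = rcp ab.
    apply: min_ab; apply/rcp_leE; rewrite -E.
    by split; apply/rprincipal_subP; [exists x | exists y].
  rewrite -{}Ecd in min_ab *; set c := a * x in cd min_ab *.
  (* (c, 1 - c) is minimal, hence so is (c ^ 2, 1 - c): c = c ^ 2 z, and then
     1 - c z annihilates c on the right, so lies in (1 - c)R. *)
  have cop2 : right_coprime (c * c) (1 - c).
    apply/right_coprimeP; exists 1, (1 + c).
    rewrite mulr1 mulrBl mul1r mulrDr mulr1 opprD !addrA addrK addrAC subrr.
    by rewrite add0r.
  have /rcp_eqE[/rprincipal_eqP[_ [z cz]] _] : rcp cop2 = rcp cd.
    apply: min_ab; apply/rcp_leE; split=> //; apply/rprincipal_subP.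
    by exists c.
  have c0 : c * (1 - c * z) = 0 by rewrite mulrBr mulr1 mulrA -cz subrr.
  have cop3 : right_coprime (c * z) (1 - c * z) by apply: idempotent_coprime.
  have /rcp_eqE[_ /rprincipal_eqP[_ [w dw]]] : rcp cop3 = rcp cd.
    apply: min_ab; apply/rcp_leE; split; apply/rprincipal_subP.
      by exists z.
    by exists (1 - c * z); rewrite mulrBl c0 subr0 mul1r.
  exists c; split; last exact/rcp_eqE.
  have: c * (1 - c) = 0 by rewrite dw mulrA c0 mul0r.
  by rewrite mulrBr mulr1 => /subr0_eq.
have [a [b [ab ->]]] := rcpP q.
move=> /rcp_leE[/rprincipal_subP[x ax] /rprincipal_subP[y by_]].
have /right_coprimeP[z [w zw]] := ab.
apply/rcp_eqE; split; apply/rprincipal_eqP; split; [by exists x| |by exists y|].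
  exists z; rewrite -[LHS]mulr1 -zw mulrDr ax by_ !mulrA ee.
  by rewrite idempotent_mulNr // !mul0r addr0.
exists w; rewrite -[LHS]mulr1 -[X in _ * X = _]zw mulrDr ax by_ !mulrA.
by rewrite idempotent_mulNl // idempotent_compl // !mul0r add0r.
Qed.


Lemma exactly_two_minimal_eltsP : exactly_two_minimal_elts (RCP R) <->
  forall e, e * e = e -> e = 0 \/ e = 1.
Proof.
pose pr e := rcp (idempotent_coprime e).
have pr0 e : pr e = pr 0 -> e = 0.
  by move/rcp_eqE=> [/rprincipal_eqP[[x ->] _] _]; rewrite mul0r.
have pr1 e : pr e = pr 1 -> e = 1.
  move/rcp_eqE=> [_ /rprincipal_eqP[[x] + _]].
  by rewrite subrr mul0r => /eqP; rewrite subr_eq0 eq_sym => /eqP.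
have min_pr e : e * e = e -> minimal_elt (pr e).
  by move=> ee; apply/minimal_rcpP; exists e.
have min0 : minimal_elt (pr 0) by apply: min_pr; rewrite mulr0.
have min1 : minimal_elt (pr 1) by apply: min_pr; rewrite mulr1.
have pr01 : pr 0 <> pr 1 by move/pr1/eqP; rewrite eq_sym oner_eq0.
split=> [[p [q [_ E]]] e ee|idem01].
  have in_pq r : minimal_elt r -> r = p \/ r = q.
    by move=> mr; have : [set r | minimal_elt r] r by []; rewrite E.
  have [Ee|Ee] : pr e = pr 0 \/ pr e = pr 1.
  - have := in_pq _ (min_pr e ee); have := in_pq _ min0; have := in_pq _ min1.
    by case=> E1 [] E0; case=> Ee; rewrite ?Ee ?E0 ?E1; auto;
       case: pr01; rewrite E0 E1.
  - by left; apply: pr0.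
  - by right; apply: pr1.
exists (pr 0), (pr 1); split; first exact/eqP.
apply/seteqP; split=> [_ /minimal_rcpP[e [/idem01[->|->] ->]]|_ [] ->] //.
  by left.
by right.
Qed.

(** * Right ideals, indecomposability and locality *)

Lemma right_scaleE x y : (x : R^c) *: (y : R^c^o) = (y * x : R).
Proof. by []. Qed.

Lemma submodule_rprincipal a : submodule (rprincipal a : set R^c^o).
Proof.
apply/submoduleP; split; first by apply/rprincipalP; exists 0; rewrite mulr0.
move=> s _ _ [x _ <-] [y _ <-]; exists (x * s + y) => //.
by rewrite mulrDr mulrA.
Qed.

Lemma right_submoduleM (A : set R^c^o) x y : submodule A -> A x -> A (x * y).
Proof. exact: (@submoduleZ _ R^c^o A y x). Qed.

Lemma right_submodule1 (A : set R^c^o) x : submodule A -> A (1 : R) -> A x.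
Proof. by move=> sA A1; rewrite -[x]mul1r; apply: right_submoduleM. Qed.

(** Writing 1 = a + b along [A] and [B], the element a - a a = b a lies in both summands, so a is
    idempotent; its value 0 or 1 kills [A] or [B]. *)
Lemma indecomposableP : indecomposable R^c^o <->
  forall e, e * e = e -> e = 0 \/ e = 1.
Proof.
split=> [[_ indec] e ee|idem01].
  have [|E0|E0] := indec _ _ (submodule_rprincipal e)
                              (submodule_rprincipal (1 - e)).
  - apply: direct_sum2P; try exact: submodule_rprincipal.
      move=> _ [x _ <-] [y _ xy].
      by rewrite -ee -mulrA -xy mulrA idempotent_mulNr // mul0r.
    move=> x; exists (e * x), ((1 - e) * x).
    by split; [exists x | exists x | rewrite mulrBl mul1r addrC subrK].
  - left; have : rprincipal e e by apply/rprincipalP; exists 1; rewrite mulr1.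
    by rewrite E0.
  - right; have : rprincipal (1 - e) (1 - e).
      by apply/rprincipalP; exists 1; rewrite mulr1.
    by rewrite E0 => /eqP; rewrite subr_eq0 eq_sym => /eqP.
split; first by exists (1 : R); apply: oner_neq0.
move=> A B sA sB AB.
have cap0 x : A x -> B x -> x = 0.
  exact: (@direct_sum2_capE _ R^c^o A B x sA sB AB).
have [a [b [Aa Bb E]]] : exists a b : R, [/\ A a, B b & 1 = a + b :> R].
  by have [[a b] [[/= Aa Bb E] _]] := AB (1 : R); exists a, b.
have aaE : a * a = a.
  apply/subr0_eq/cap0.
    by apply: (@submoduleB _ R^c^o) => //; apply: right_submoduleM.
  have -> : a * a - a = - (b * a) :> R.
    by rewrite -[X in _ - X]mul1r -mulrBl E opprD addrA subrr add0r mulNr.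
  by apply: (@submoduleN _ R^c^o) => //; apply: right_submoduleM.
have [a0|a1] := idem01 _ aaE; [left|right]; apply/seteqP; split=> x.
- move=> Ax; apply: (cap0 _ Ax); apply: right_submodule1 => //.
  by rewrite E a0 add0r.
- by move=> ->; apply: submodule0.
- move=> Bx; apply: cap0 => //; apply: right_submodule1 => //.
  by rewrite -a1.
- by move=> ->; apply: submodule0.
Qed.

Lemma exists_maximal_right_ideal (A : set R) :
  submodule (A : set R^c^o) -> ~ A 1 ->
  exists M, maximal_right_ideal M /\ A `<=` M.
Proof. exact: exists_maximal_submodule. Qed.

Lemma maximal_right_ideal_not1 (M : set R) : maximal_right_ideal M -> ~ M 1.
Proof. exact: maximal_submodule_not1. Qed.

Lemma maximal_right_ideal_add (M : set R) x : maximal_right_ideal M -> ~ M x ->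
  exists m s, M m /\ 1 = m + x * s.
Proof. exact: maximal_submodule_add. Qed.

(** Triviality read off a representative: when a x = 1, aR = R and a can be replaced by the unit 1
    within the class. *)
Definition trivial_pairs := forall a b, right_coprime a b ->
  (exists x, a * x = 1) \/ (exists x, b * x = 1).

(** An element without right inverse lies in a maximal right ideal; if there is only one, two such
    elements cannot be coprime. Two distinct maximal right ideals give 1 = m + x s with neither
    summand right invertible. *)
Lemma local_ringP : local_ring R <-> trivial_pairs.
Proof.
split=> [[M [maxM Muniq]] a b ab|triv].
  have inM c : ~ (exists x, c * x = 1) -> M c.
    move=> c1; have [|M' [maxM' cM']] :=
      exists_maximal_right_ideal (submodule_rprincipal c).
      by move/rprincipalP=> [x cx]; apply: c1; exists x.
    by rewrite (Muniq _ maxM'); apply: cM'; exists 1; rewrite ?mulr1.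
  apply: contrapT => /not_orP[/inM Ma /inM Mb].
  have /right_coprimeP[x [y xy]] := ab; have [sM _ _] := maxM.
  apply: (maximal_right_ideal_not1 maxM); rewrite -xy.
  by apply: (@submoduleD _ R^c^o) => //; apply: right_submoduleM.
have [|M [maxM _]] := exists_maximal_right_ideal (submodule_rprincipal 0).
  by move/rprincipalP=> [x /eqP]; rewrite mul0r oner_eq0.
exists M; split=> // M' maxM'; have [sM _ _] := maxM; have [sM' MT' _] := maxM'.
have [M'M|] := pselect (M' `<=` M).
  have [_ _ max] := maxM'; have [//|MT] := max _ sM M'M.
  by have [_ /eqP] := maxM.
move=> /existsNP[x /not_implyP[M'x Mx]].
have [m [s [Mm E]]] := maximal_right_ideal_add maxM Mx.
have /triv : right_coprime m (x * s).
  by apply/right_coprimeP; exists 1, 1; rewrite !mulr1.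
case=> -[y my].
  case: (maximal_right_ideal_not1 maxM); rewrite -my.
  exact: right_submoduleM.
case: (maximal_right_ideal_not1 maxM'); rewrite -my.
by do 2!apply: right_submoduleM => //.
Qed.

Lemma rcp_triv_l a b (ab : right_coprime a b) x : a * x = 1 ->
  rcp ab = rcp (coprime1r b).
Proof.
move=> ax; apply/rcp_eqE; split=> //; apply/rprincipal_eqP.
by split; [exists a; rewrite mul1r | exists x].
Qed.

Lemma rcp_triv_r a b (ab : right_coprime a b) x : b * x = 1 ->
  rcp ab = rcp (coprime1l a).
Proof.
move=> bx; apply/rcp_eqE; split=> //; apply/rprincipal_eqP.
by split; [exists b; rewrite mul1r | exists x].
Qed.

Lemma trivial_pairsP : trivial_pairs <-> forall p, rcp_trivial p.
Proof.
have unit1 : is_unit (1 : R) by exists 1; rewrite mulr1.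
split=> [triv p|triv a b ab].
  have [a [b [ab ->]]] := rcpP p; have [[x ax]|[x bx]] := triv _ _ ab.
    exists b, 1; split=> //; right; exists (coprime1r b).
    exact: rcp_triv_l ax.
  exists a, 1; split=> //; left; exists (coprime1l a).
  exact: rcp_triv_r bx.
have [c [u [[v [uv _]]]]] := triv (rcp ab).
move=> [] [h /rcp_eqE[/rprincipal_eqP[_ [x ux]] /rprincipal_eqP[_ [y uy]]]].
  by right; exists (y * v); rewrite mulrA -uy.
by left; exists (x * v); rewrite mulrA -ux.
Qed.

Definition minimal_below := forall p, exists q, minimal_elt q /\ (q <= p)%O.

Lemma minimal_belowP : minimal_below <-> forall a b, right_coprime a b ->
  exists e x y, [/\ e * e = e, e = a * x & 1 - e = b * y].
Proof.
split=> [min a b ab|min p].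
  have [q [/minimal_rcpP[e [ee ->]]]] := min (rcp ab).
  move=> /rcp_leE[/rprincipal_subP[x ex] /rprincipal_subP[y ey]].
  by exists e, x, y.
have [a [b [ab ->]]] := rcpP p; have [e [x [y [ee ex ey]]]] := min a b ab.
exists (rcp (idempotent_coprime e)); split.
  by apply/minimal_rcpP; exists e.
by apply/rcp_leE; split; apply/rprincipal_subP; [exists x | exists y].
Qed.

Lemma trivial_pairs_minimal : trivial_pairs <->
  exactly_two_minimal_elts (RCP R) /\ minimal_below.
Proof.
rewrite exactly_two_minimal_eltsP minimal_belowP.
split=> [triv|[idem01 min] a b ab].
  split=> [e ee|a b ab].
    have [[x ex]|[x ex]] := triv _ _ (idempotent_coprime e).
      by right; rewrite -[LHS]mulr1 -[X in _ * X]ex mulrA ee.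
    by left; rewrite -[LHS]mulr1 -[X in _ * X]ex mulrA idempotent_mulNr ?mul0r.
  have [[x ax]|[x bx]] := triv _ _ ab.
    by exists 1, x, 0; rewrite mulr1 subrr mulr0 ax.
  by exists 0, 0, x; rewrite subr0 !mulr0 bx.
have [e [x [y [/idem01[]-> ex ey]]]] := min a b ab; last by left; exists x.
by right; exists y; rewrite -ey subr0.
Qed.

Lemma von_neumann_regularP :
  von_neumann_regular R <-> forall p, rcp_regular p.
Proof.
split=> [reg p|reg a].
  by have [a [b [ab ->]]] := rcpP p; apply/rcp_regularE.
by have /rcp_regularE[] := reg (rcp (coprime1l a)).
Qed.

Lemma left_coprimeP a b :
  left_coprime a b <-> exists x y, x * a + y * b = 1.
Proof.
split=> [ab|[x [y xy]]].
  have : setT (1 : R) by []; rewrite -ab => -[_ [x _ <-] [_ [y _ <-]]] E.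
  by exists x, y.
apply/seteqP; split=> // z _.
exists (z * x * a); first by exists (z * x).
by exists (z * y * b); [exists (z * y) | rewrite -!mulrA -mulrDr xy mulr1].
Qed.

Lemma right_quasi_duoP : right_quasi_duo R <->
  forall a b, left_coprime a b -> right_coprime a b.
Proof.
split=> [duo a b /left_coprimeP[x [y xy]]|lr M maxM].
  apply: contrapT => ab.
  have [||M [maxM IM]] := @exists_maximal_right_ideal
    [set z | exists s t, z = a * s + b * t].
  - apply/submoduleP; split; first by exists 0, 0; rewrite !mulr0 addr0.
    move=> r _ _ [s [t ->]] [s' [t' ->]]; exists (s * r + s'), (t * r + t').
    by rewrite right_scaleE mulrDl !mulrDr !mulrA addrACA.
  - by move=> [s [t E]]; apply: ab; apply/right_coprimeP; exists s, t.
  have lM := duo _ maxM; apply: (maximal_right_ideal_not1 maxM).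
  rewrite -xy; apply: (@submoduleD _ R^o) => //.
    apply: (@submoduleZ _ R^o) => //; apply: IM.
    by exists 1, 0; rewrite mulr0 mulr1 addr0.
  apply: (@submoduleZ _ R^o) => //; apply: IM.
  by exists 0, 1; rewrite mulr0 mulr1 add0r.
have [sM _ _] := maxM; apply/submoduleP; split; first exact: (submodule0 sM).
move=> r u v Mu Mv; apply: (@submoduleD _ R^c^o) => //; apply: contrapT => Mru.
have [n [s [Mn E]]] := maximal_right_ideal_add maxM Mru.
(* Both entries lie in [M], and r (u s) + n = 1; right coprimality then puts 1 in [M]. *)
have /right_coprimeP[x [y xy]] : right_coprime (u * s) n.
  by apply/lr/left_coprimeP; exists r, 1; rewrite mul1r mulrA addrC -E.
apply: (maximal_right_ideal_not1 maxM); rewrite -xy.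
by apply: (@submoduleD _ R^c^o) => //; do ?apply: right_submoduleM.
Qed.

End CoprimePairs.

(** * Exchange rings *)

(* For x = r - s, where r e = r and s (1 - e) = s, both sides are governed by
   the same equation a x - x b + x a b x = 1 (note that a x - x b = x a - b x):
   it makes e = a + a b x and h = a + x a b idempotent. *)
Lemma exchange_element_symm (S : nzRingType) (a b e r s : S) :
  a + b = 1 -> e * e = e -> e = a * r -> 1 - e = b * s ->
  exists h x y, [/\ h * h = h, h = x * a & 1 - h = y * b].
Proof.
move=> ab ee ear fbs.
have E1 : exists r s,
    [/\ e = a * r, 1 - e = b * s, r * (1 - e) = 0 & s * (1 - e) = s].
  exists (r * e), (s * (1 - e)).
  rewrite !mulrA -ear -fbs ee idempotent_compl // -!mulrA.
  by rewrite idempotent_mulNr // mulr0 idempotent_compl.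
move: E1 => {r s ear fbs} [r [s [ear fbs rf sf]]].
have bE : b = 1 - a by rewrite -ab addrC addKr.
have abC : a * b = b * a by rewrite bE mulrBr mulrBl mulr1 mul1r.
have [x [ax xf]] : exists x, a * x = 1 - s /\ x * (1 - e) = - s.
  exists (r - s); rewrite [(r - s) * (1 - e)]mulrBl rf sf sub0r; split=> //.
  have -> : a * (r - s) = e - (s - (1 - e)).
    rewrite mulrBr -ear fbs -[X in X - b * s]mul1r -mulrBl.
    by rewrite -{1}ab addrK.
  by rewrite opprB addrA [e + _]addrC subrK.
have xbs : (1 + x * b) * s = 0 by rewrite mulrDl mul1r -mulrA -fbs xf subrr.
(* From h x = 1 + x b follows h (1 - x a) = h - h = 0; since 1 - h = (1 - x a) b, this gives h (1 -
   h) = 0. *)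
pose h := (1 + x * b) * a.
have hx : h * x = 1 + x * b.
  by rewrite -mulrA ax mulrBr mulr1 xbs subr0.
have hE : 1 - h = (1 - x * a) * b.
  by rewrite /h mulrBl mulrDl !mul1r -!mulrA abC opprD addrA -bE.
exists h, (1 + x * b), (1 - x * a); split=> //.
apply/eqP; rewrite eq_sym -subr_eq0 -[X in X - _]mulr1 -mulrBr hE mulrA.
by rewrite mulrBr mulr1 mulrA hx -/h subrr mul0r.
Qed.

(* exchange_ring R is exchange R^c. *)
Definition exchange (S : nzRingType) :=
  forall (X : lmodType S) (M N A B : set X),
    submodule M -> submodule N -> submodule A -> submodule B ->
    direct_sum2 M N -> direct_sum2 A B -> isomorphic_to M S^o ->
    exists A' B' : set X,
      [/\ submodule A', submodule B', A' `<=` A, B' `<=` B &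
          direct_sum3 M A' B'].

Definition exchange_elements (S : nzRingType) :=
  forall a b : S, a + b = 1 ->
    exists e x y, [/\ e * e = e, e = a * x & 1 - e = b * y].

(* Apply the exchange property to the summand S(a, b) of S^2. *)
Lemma exchange_sub_exchange_elements (S : nzRingType) :
  exchange S -> exchange_elements S.
Proof.
move=> ex a b ab.
pose X : lmodType S := (S^o * S^o)%type.
(* As a + b = 1, the sum map (x, y) -> x + y sends r (a, b) to r: [M] is free on (a, b), and the
   kernel [N] of this map complements it. *)
pose M : set X := [set (r * a, r * b) | r in [set: S]].
pose N : set X := [set (r, - r) | r in [set: S]].
pose A : set X := [set (r, 0) | r in [set: S]].
pose B : set X := [set (0, r) | r in [set: S]].
have pairE (s x y : S) : s *: ((x, y) : X) = (s * x, s * y) by [].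
have pairD (x y x' y' : S) :
  ((x, y) : X) + ((x', y') : X) = (x + x', y + y') by [].
have sM : submodule M.
  apply/submoduleP; split; first by exists 0; rewrite // !mul0r.
  move=> s _ _ [x _ <-] [y _ <-]; exists (s * x + y) => //.
  by rewrite pairE pairD !mulrDl !mulrA.
have sN : submodule N.
  apply/submoduleP; split; first by exists 0; rewrite // oppr0.
  move=> s _ _ [x _ <-] [y _ <-]; exists (s * x + y) => //.
  by rewrite pairE pairD opprD mulrN.
have sA : submodule A.
  apply/submoduleP; split; first by exists 0.
  move=> s _ _ [x _ <-] [y _ <-]; exists (s * x + y) => //.
  by rewrite pairE pairD mulr0 addr0.
have sB : submodule B.
  apply/submoduleP; split; first by exists 0.
  move=> s _ _ [x _ <-] [y _ <-]; exists (s * x + y) => //.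
  by rewrite pairE pairD mulr0 addr0.
have MN : direct_sum2 M N.
  apply: direct_sum2P => // [_ [r _ <-] [s _ [sr sr']]|[x y]].
    have -> : r = 0 by rewrite -[r]mulr1 -ab mulrDr -sr -sr' subrr.
    by rewrite !mul0r.
  exists ((x + y) * a, (x + y) * b), (x - (x + y) * a, - (x - (x + y) * a)).
  split; [by exists (x + y) | by exists (x - (x + y) * a) |].
  rewrite pairD addrC subrK; congr pair; rewrite opprB addrA -mulrDr.
  by rewrite [b + a]addrC ab mulr1 addrC addKr.
have AB : direct_sum2 A B.
  apply: direct_sum2P => //; first by move=> _ [r _ <-] [s _ [<-]].
  move=> [x y]; exists (x, 0), (0, y); split; [by exists x | by exists y |].
  by rewrite pairD addr0 add0r.
pose f (r : S^o) : X := (r * a, r * b).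
have f_lin : linear f by move=> s x y; rewrite /f !mulrDl pairE pairD !mulrA.
pose fL : {linear S^o -> X} := HB.pack f (GRing.isLinear.Build _ _ _ _ f f_lin).
have isoM : isomorphic_to M S^o.
  exists fL; split=> // r s [ra rb].
  by rewrite -[r]mulr1 -[s]mulr1 -ab !mulrDr ra rb.
have [A' [B' [sA' sB' A'A B'B MAB]]] := ex X M N A B sM sN sA sB MN AB isoM.
have decomp_uniq (m n k m' n' k' : X) : M m -> A' n -> B' k -> M m' -> A' n' ->
    B' k' -> m + n + k = m' + n' + k' -> [/\ m = m', n = n' & k = k'].
  move=> Mm An Bk Mm' An' Bk' E; have [y [_ yu]] := MAB (m + n + k).
  have E1 := yu ((m, n), k) (And4 Mm An Bk erefl).
  by have := yu ((m', n'), k') (And4 Mm' An' Bk' E); rewrite E1 => -[-> -> ->].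
have [[[m n] k] [[/= Mm An Bk E] _]] := MAB (1, 0).
have [[[m' n'] k'] [[/= Mm' An' Bk' E'] _]] := MAB (0, 1).
case: (Mm) => r _ mE; case: (Mm') => s _ mE'.
have [x _ nE] := A'A _ An; have [y _ kE] := B'B _ Bk.
(* Compare [M]-components in (a, b) = a (1, 0) + b (0, 1). *)
have rs1 : a * r + b * s = 1.
  have [|||||||E1 _ _] := decomp_uniq (a, b) 0 0 (a *: m + b *: m')
    (a *: n + b *: n') (a *: k + b *: k').
  - by exists 1; rewrite // !mul1r.
  - exact: submodule0.
  - exact: submodule0.
  - by apply: submoduleD; rewrite //; apply: submoduleZ.
  - by apply: submoduleD; rewrite //; apply: submoduleZ.
  - by apply: submoduleD; rewrite //; apply: submoduleZ.
  - have -> : (a, b) = a *: (1, 0) + b *: (0, 1) :> X.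
      by rewrite !pairE pairD !mulr0 !mulr1 addr0 add0r.
    by rewrite !addr0 E E' !scalerDr [LHS]addrACA [X in X + _ = _]addrACA.
  move: E1; rewrite -mE -mE' !pairE pairD !mulrA -!mulrDl => -[Ea Eb].
  by rewrite -[LHS]mulr1 -ab mulrDr -Ea -Eb ab.
(* The [A']-component (x, 0) of (1, 0) is also x (1, 0), whose [M]-component x r (a, b) must
   therefore vanish. As x = 1 - r a, this says r a r = r, so a r is idempotent. *)
have xr0 : x * r = 0.
  have [|||||||E1 _ _] := decomp_uniq 0 n 0 (x *: m) (x *: n) (x *: k).
  - exact: submodule0.
  - by [].
  - exact: submodule0.
  - exact: submoduleZ.
  - exact: submoduleZ.
  - exact: submoduleZ.
  - by rewrite -!scalerDr -E -nE pairE mulr0 mulr1 addr0 add0r.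
  move: E1; rewrite -mE pairE !mulrA => -[Ea Eb].
  by rewrite -[LHS]mulr1 -ab mulrDr -Ea -Eb addr0.
have xE : x = 1 - r * a.
  move: E; rewrite -mE -nE -kE !pairD !addr0 => -[-> _].
  by rewrite addrC addKr.
exists (a * r), r, s; split=> //; last by rewrite -rs1 addrC addKr.
rewrite -mulrA; congr (_ * _).
by apply/eqP; rewrite eq_sym -subr_eq0 -[X in X - _]mul1r mulrA -mulrBl -xE xr0.
Qed.

Lemma direct_sum2_proj (S : nzRingType) (X : lmodType S) (A B : set X) :
  submodule A -> submodule B -> direct_sum2 A B ->
  exists p q : X -> X,
    [/\ forall x, A (p x), forall x, B (q x), forall x, x = p x + q x,
        forall s x y, p (s *: x + y) = s *: p x + p y &
        [/\ forall s x y, q (s *: x + y) = s *: q x + q y,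
            forall x, A x -> p x = x /\ q x = 0 &
            forall x, B x -> p x = 0 /\ q x = x]].
Proof.
move=> sA sB AB; have [f fP] := choice AB.
have f_eq x y z : A y -> B z -> x = y + z -> f x = (y, z).
  by move=> Ay Bz xE; apply: (fP x).2.
have fA x : A (f x).1 by have [[]] := fP x.
have fB x : B (f x).2 by have [[]] := fP x.
have fE x : x = (f x).1 + (f x).2 by have [[]] := fP x.
have f_lin s x y : f (s *: x + y)
    = (s *: (f x).1 + (f y).1, s *: (f x).2 + (f y).2).
  apply: f_eq; [| |by rewrite addrACA -scalerDr -!fE].
    by apply: submoduleD => //; apply: submoduleZ.
  by apply: submoduleD => //; apply: submoduleZ.
exists (fun x => (f x).1), (fun x => (f x).2); split=> //.
  by move=> s x y; rewrite f_lin.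
split=> [s x y|x Ax|x Bx]; first by rewrite f_lin.
  by rewrite (f_eq x x 0) ?addr0 //; apply: submodule0.
by rewrite (f_eq x 0 x) ?add0r //; apply: submodule0.
Qed.

(** With [u] the generator of [M] and [pi] the coordinate along it, the idempotent found for pi (al
    u) + pi (be u) = 1 yields a linear form [phi] with phi u = 1. Hence X is the direct sum of S u
    and the kernel of [phi], and this kernel is the sum of its traces [A'] on [A] and [B'] on
    [B]. *)
Lemma exchange_elements_sub_exchange (S : nzRingType) :
  exchange_elements S -> exchange S.
Proof.
move=> exS X M N A B sM sN sA sB MN AB [i [i_inj iM]].
have [pM [qM [pMM _ _ pM_lin [_ pM_id _]]]] := direct_sum2_proj sM sN MN.
have [al [be [alA beB abE al_lin [be_lin ab_A ab_B]]]] :=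
  direct_sum2_proj sA sB AB.
have /choice[pi piE] : forall x, exists s : S, i s = pM x.
  by move=> x; have : M (pM x) by []; rewrite -iM => -[s _ <-]; exists s.
have pi_lin s x y : pi (s *: x + y) = s * pi x + pi y.
  by apply: i_inj; rewrite piE pM_lin -!piE -linearP.
have pi0 : pi 0 = 0.
  by have := pi_lin (- 1) 0 0; rewrite scaler0 addr0 mulN1r addNr.
pose u : X := i (1 : S).
have iE (s : S) : i s = s *: u by rewrite -linearZ /= [s *: _]mulr1.
have Mu : M u by rewrite -iM; exists (1 : S).
have piu : pi u = 1 by apply: i_inj; rewrite piE (pM_id u Mu).1.
have [|e [r0 [s0 [ee er fs]]]] := exS (pi (al u)) (pi (be u)).
  by rewrite -[pi (al u)]mul1r -pi_lin scale1r -abE.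
pose f := 1 - e.
have ff : f * f = f by apply: idempotent_compl.
(* Now r f = 0 and s e = 0, so multiplying [phi] by e or f isolates its part on [A] or on [B]. *)
pose r := r0 * e; pose s := s0 * f.
have re : r * e = r by rewrite -mulrA ee.
have se : s * e = 0 by rewrite -mulrA idempotent_mulNl // mulr0.
have rf : r * f = 0 by rewrite -mulrA idempotent_mulNr // mulr0.
have sf : s * f = s by rewrite -mulrA ff.
have ar : pi (al u) * r = e by rewrite mulrA -er ee.
have bs : pi (be u) * s = f by rewrite mulrA -fs ff.
have fE : e + f = 1 by rewrite addrC subrK.
clearbody r s f.
pose phi x := pi (al x) * r + pi (be x) * s.
have phi_lin t x y : phi (t *: x + y) = t * phi x + phi y.
  rewrite /phi al_lin be_lin !pi_lin !mulrDl mulrDr !mulrA.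
  by rewrite addrACA.
have phiu : phi u = 1 by rewrite /phi ar bs.
pose A' := [set x : X | A x /\ pi x * r = 0].
pose B' := [set x : X | B x /\ pi x * s = 0].
have sA' : submodule A'.
  apply/submoduleP; split.
    by split; [apply: submodule0 | rewrite pi0 mul0r].
  move=> t x y [Ax xr] [Ay yr]; split.
    by apply: submoduleD => //; apply: submoduleZ.
  by rewrite pi_lin mulrDl -mulrA xr yr mulr0 addr0.
have sB' : submodule B'.
  apply/submoduleP; split.
    by split; [apply: submodule0 | rewrite pi0 mul0r].
  move=> t x y [Ax xr] [Ay yr]; split.
    by apply: submoduleD => //; apply: submoduleZ.
  by rewrite pi_lin mulrDl -mulrA xr yr mulr0 addr0.
exists A', B'; split=> //; [by move=> x [] | by move=> x [] |].
move=> x; pose t := phi x.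
have pi_sub y : pi (- t *: y + x) = pi x - t * pi y.
  by rewrite pi_lin mulNr addrC.
exists (t *: u, - t *: al u + al x, - t *: be u + be x); split.
  split=> /=.
  - exact: submoduleZ.
  - split; first by apply: submoduleD => //; apply: submoduleZ.
    rewrite pi_lin mulrDl !mulNr -mulrA ar /t /phi mulrDl -!mulrA.
    by rewrite re se mulr0 addr0 addNr.
  - split; first by apply: submoduleD => //; apply: submoduleZ.
    rewrite pi_lin mulrDl !mulNr -mulrA bs /t /phi mulrDl -!mulrA.
    by rewrite rf sf mulr0 add0r addNr.
  - rewrite -addrA addrACA -scalerDr -!abE.
    by rewrite scaleNr addrA subrr add0r.
move=> [[m n] k] [/= Mm [An nr] [Bk ks] xE].
have phiA y : A y -> pi y * r = 0 -> phi y = 0.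
  by move=> Ay yr; rewrite /phi (ab_A y Ay).1 (ab_A y Ay).2 yr pi0 mul0r addr0.
have phiB y : B y -> pi y * s = 0 -> phi y = 0.
  by move=> By yr; rewrite /phi (ab_B y By).1 (ab_B y By).2 yr pi0 mul0r addr0.
have [z mE] : exists z, m = z *: u.
  by move: Mm; rewrite -iM => -[z _ <-]; exists z; rewrite iE.
have xE' : x = z *: u + (1 *: n + k) by rewrite scale1r xE mE addrA.
have tz : t = z.
  by rewrite /t xE' !phi_lin phiu (phiA n) // (phiB k) // mulr0 !addr0 mulr1.
have [alk bek] := ab_B k Bk; have [aln ben] := ab_A n An.
have -> : al x = t *: al u + n.
  by rewrite {1}xE' !al_lin aln alk scale1r addr0 tz.
have -> : be x = t *: be u + k.
  by rewrite {1}xE' !be_lin ben bek scaler0 add0r tz.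
rewrite mE tz.
congr ((_, _), _).
  by rewrite addrA scaleNr addNr add0r.
by rewrite addrA scaleNr addNr add0r.
Qed.

(** The exchange property over [R^c] places idempotents in principal left ideals of [R];
    [exchange_element_symm] moves them to right ideals and back. *)
Lemma exchange_ringP (R : nzRingType) : exchange_ring R <-> minimal_below R.
Proof.
rewrite minimal_belowP; split=> [exR a b /right_coprimeP[x [y xy]]|exR].
  have [e [r [s [ee er es]]]] := @exchange_sub_exchange_elements R^c exR _ _ xy.
  have [h [r' [s' [hh hr hs]]]] :=
    @exchange_element_symm R^c _ _ e r s xy ee er es.
  by exists h, (x * r'), (y * s'); rewrite !mulrA.
apply: (@exchange_elements_sub_exchange R^c) => a b ab.
have [|e [r [s [ee er es]]]] := exR a b.
  by apply/right_coprimeP; exists 1, 1; rewrite !mulr1.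
have [h [r' [s' [hh hr hs]]]] :=
  @exchange_element_symm R _ _ e r s ab ee er es.
by exists h, r', s'.
Qed.

(** * The Jacobson radical and its quotient ring *)

Section JacobsonRadical.
Variable R : nzRingType.
Implicit Types x y z r : R.

Local Notation J := (@jacobson_radical R).

Lemma jacobson_submodule : submodule (J : set R^o).
Proof.
apply/submoduleP; split=> [M [sM _ _]|s u v Ju Jv M maxM].
  exact: submodule0.
have [sM _ _] := maxM; apply: submoduleD; rewrite //; last exact: Jv.
by apply: submoduleZ; rewrite //; apply: Ju.
Qed.

(** If R(1 - r x) is proper, a maximal left ideal above it cannot contain [x]. Conversely, [x]
    outside a maximal [M] gives 1 = m + s x, and a left inverse of m = 1 - s x puts 1 in [M]. *)
Lemma jacobsonP x : J x <-> forall r, exists y, y * (1 - r * x) = 1.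
Proof.
split=> [Jx r|inv M maxM].
  apply: contrapT => ninv.
  have [||M [maxM IM]] :=
    @exists_maximal_submodule R [set z | exists y, z = y * (1 - r * x)].
  - apply/submoduleP; split; first by exists 0; rewrite mul0r.
    by move=> s _ _ [y ->] [z ->]; exists (s * y + z); rewrite mulrDl -mulrA.
  - by move=> [y E]; apply: ninv; exists y.
  have [sM _ _] := maxM; apply: (maximal_submodule_not1 maxM).
  rewrite -[1](subrK (r * x)).
  apply: (@submoduleD _ R^o) => //; first by apply: IM; exists 1; rewrite mul1r.
  by apply: (@submoduleZ _ R^o _ r) => //; apply: Jx.
apply: contrapT => Mx.
have [m [s [Mm E]]] := maximal_submodule_add maxM Mx; have [y yE] := inv s.
have [sM _ _] := maxM; apply: (maximal_submodule_not1 maxM); rewrite -yE.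
by apply: (@submoduleZ _ R^o _ y) => //; rewrite E addrK.
Qed.

Lemma jacobsonMl r x : J x -> J (r * x).
Proof. by apply: (@submoduleZ _ R^o); apply: jacobson_submodule. Qed.

Lemma jacobsonMr x z : J x -> J (x * z).
Proof.
move=> Jx; apply/jacobsonP => r.
have /jacobsonP/(_ 1)[u] : J (z * r * x) by apply: jacobsonMl.
(* With q = r x: if u is a left inverse of 1 - z q, then 1 + q u z is one of 1 - q z. *)
rewrite mul1r => uE; exists (1 + r * x * u * z).
rewrite mulrDl mul1r -[X in _ + X]mulrA.
have -> : z * (1 - r * (x * z)) = (1 - z * r * x) * z.
  by rewrite mulrBr mulrBl mulr1 mul1r !mulrA.
by rewrite -(mulrA (r * x)) (mulrA u) uE mul1r mulrA subrK.
Qed.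

Lemma jacobson0 : J 0. Proof. exact: submodule0 jacobson_submodule. Qed.

Lemma jacobsonD x y : J x -> J y -> J (x + y).
Proof. exact: (@submoduleD _ R^o _ x y jacobson_submodule). Qed.

Lemma jacobsonN x : J x -> J (- x).
Proof. exact: (@submoduleN _ R^o _ x jacobson_submodule). Qed.

Lemma jacobson_not1 : ~ J 1.
Proof.
move/jacobsonP/(_ 1)=> [y /eqP].
by rewrite mulr1 subrr mulr0 eq_sym oner_eq0.
Qed.

(** A left inverse y of 1 - x equals 1 + y x, which has a left inverse too because y x lies in the
    radical; so y is two-sided. *)
Lemma jacobson_inv x : J x -> exists y, y * (1 - x) = 1 /\ (1 - x) * y = 1.
Proof.
move=> Jx; have /jacobsonP/(_ 1)[y] := Jx; rewrite mul1r => yx.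
have /jacobsonP/(_ 1)[z] : J (- (y * x)).
  by apply: jacobsonN; apply: jacobsonMl.
have -> : 1 - 1 * - (y * x) = y.
  rewrite mul1r opprK -[RHS](subrK (y * x)) -[X in _ = X - _ + _]mulr1.
  by rewrite -mulrBr yx.
move=> zy; exists y; split=> //; move: (1 - x) yx => w yw.
by have -> : w = z by rewrite -[w]mul1r -zy -mulrA yw mulr1.
Qed.

(** If u inverts 1 - r x r x on the left, then u (1 + r x) inverts 1 - r x. *)
Lemma jacobson_semiprime x : (forall r, J (x * r * x)) -> J x.
Proof.
move=> Jxx; apply/jacobsonP => r.
have /jacobsonP/(_ r)[u uE] := Jxx r.
exists (u * (1 + r * x)); rewrite -mulrA mulrDl mul1r mulrBr mulr1.
by rewrite addrA subrK -(mulrA r) (mulrA x).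
Qed.

(** Products are taken on chosen representatives of the additive quotient; [pM], their independence
    of the choice, rests on the radical being two-sided. *)
Lemma jacobson_quotient : exists (S : nzRingType) (f : {rmorphism R -> S}),
  range f = setT /\ forall x, f x = 0 <-> J x.
Proof.
pose I : {pred R} := [pred x | `[< J x >]].
have IE x : (x \in I) = `[< J x >] by [].
have I_closed : zmod_closed I.
  split=> [|x y]; rewrite !IE; first by apply/asboolP; apply: jacobson0.
  move=> /asboolP Jx /asboolP Jy; apply/asboolP.
  by apply: jacobsonD; rewrite //; apply: jacobsonN.
pose IZ : zmodClosed R := HB.pack I (GRing.isZmodClosed.Build R I I_closed).
pose Q := Quotient.quot IZ.
pose p : R -> Q := \pi_Q%qT.
have pE x y : p x = p y <-> J (x - y).
  split=> [/eqP|Jxy].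
    by rewrite /p -Quotient.idealrBE IE => /asboolP.
  by apply/eqP; rewrite /p -Quotient.idealrBE IE; apply/asboolP.
have p_surj q : exists x, q = p x by exists (repr q); rewrite /p reprK.
have pD x y : p (x + y) = p x + p y by rewrite /p piE.
have pN x : p (- x) = - p x by rewrite /p piE.
have p0 : p 0 = 0 by rewrite /p piE.
pose mulQ (q r : Q) : Q := p (repr q * repr r).
have pM x y : p (x * y) = mulQ (p x) (p y).
  apply/pE.
  have Jr z : J (z - repr (p z)) by apply/pE; rewrite /p reprK.
  have -> : x * y - repr (p x) * repr (p y) =
      (x - repr (p x)) * y + repr (p x) * (y - repr (p y)).
    by rewrite mulrBl mulrBr addrA subrK.
  by apply: jacobsonD; [apply: jacobsonMr | apply: jacobsonMl].
have mulQA : associative mulQ.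
  move=> q r s; have [[[x ->] [y ->]] [z ->]] := (p_surj q, p_surj r, p_surj s).
  by rewrite -!pM mulrA.
have mul1Q : left_id (p 1) mulQ.
  by move=> q; have [x ->] := p_surj q; rewrite -pM mul1r.
have mulQ1 : right_id (p 1) mulQ.
  by move=> q; have [x ->] := p_surj q; rewrite -pM mulr1.
have mulQDl : left_distributive mulQ +%R.
  move=> q r s; have [x ->] := p_surj q; have [y ->] := p_surj r.
  by have [z ->] := p_surj s; rewrite -pD -!pM -pD mulrDl.
have mulQDr : right_distributive mulQ +%R.
  move=> q r s; have [x ->] := p_surj q; have [y ->] := p_surj r.
  by have [z ->] := p_surj s; rewrite -pD -!pM -pD mulrDr.
have Q10 : p 1 != 0.
  by apply/eqP; rewrite -p0 => /pE; rewrite subr0; apply: jacobson_not1.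
pose S : nzRingType := HB.pack Q
  (GRing.Zmodule_isNzRing.Build Q mulQA mul1Q mulQ1 mulQDl mulQDr Q10).
pose f : R -> S := p.
have f_zmod : zmod_morphism f by move=> x y; rewrite /f pD pN.
have f_mono : monoid_morphism f by split=> // x y; apply: pM.
pose fR : {rmorphism R -> S} := HB.pack f
  (GRing.isZmodMorphism.Build R S f f_zmod)
  (GRing.isMonoidMorphism.Build R S f f_mono).
exists S, fR; split.
  apply/seteqP; split=> // q _; have [x ->] := p_surj q.
  by exists x.
move=> x; rewrite -[X in J X]subr0 -pE p0.
by [].
Qed.

End JacobsonRadical.

(** * From chain conditions to left perfect rings *)

(* DCC on principal right ideals, as a minimum condition on their generators. *)
Definition right_min (S : nzRingType) := forall (P : set S) x0, P x0 ->
  exists x, P x /\ forall z, P (x * z) -> exists w, x = x * z * w.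

Lemma DCC_right_min (R : nzRingType) : DCC (RCP R) -> right_min R.
Proof.
move=> dcc P x0 Px0; apply: contrapT => nmin.
have /choice[g gP] : forall x, exists z, P x ->
    P (x * z) /\ forall w, x <> x * z * w.
  move=> x; have [Px|] := pselect (P x); last by exists 0.
  apply: contrapT => nz; apply: nmin; exists x; split=> // z Pxz.
  apply: contrapT => nw; apply: nz; exists z => _; split=> // w xw.
  by apply: nw; exists w.
pose h n := iter n (fun x => x * g x) x0.
have hP n : P (h n) by elim: n => //= n /gP[].
have [|N Nstab] := dcc (fun n => rcp (coprime1l (h n))).
  move=> n; apply/rcp_leE; split=> //; apply/rprincipal_subP.
  by exists (g (h n)).
have /rcp_eqE[/rprincipal_eqP[_ [w hw]] _] := Nstab N.+1 (leqnSn N).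
by have [_ /(_ w)] := gP _ (hP N).
Qed.

Definition right_chains_stable (R : nzRingType) := forall a : nat -> R,
  exists N, forall n, (N <= n)%N ->
    exists w, \prod_(0 <= i < N) a i = \prod_(0 <= i < n) a i * w.

Lemma right_chain_le (R : nzRingType) (x : nat -> R) :
  (forall n, exists c, x n.+1 = x n * c) ->
  forall m n, (m <= n)%N -> exists c, x n = x m * c.
Proof.
move=> xS m n /subnKC <-; elim: (n - m)%N => [|k [c IH]].
  by exists 1; rewrite addn0 mulr1.
have [d dE] := xS (m + k)%N.
by exists (c * d); rewrite addnS dE IH mulrA.
Qed.

Lemma right_chain_stable (R : nzRingType) (x : nat -> R) :
  right_chains_stable R -> (forall n, exists c, x n.+1 = x n * c) ->
  exists N, forall n, (N <= n)%N -> exists w, x N = x n * w.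
Proof.
move=> stab xS; have /choice[c cE] := xS.
(* The first factor is x 0, so x n is the product of n + 1 factors. *)
pose a n := if n is k.+1 then c k else x 0.
have prodE n : \prod_(0 <= i < n.+1) a i = x n.
  elim: n => [|n IH]; first by rewrite big_nat1.
  by rewrite big_nat_recr //= IH -cE.
have [N Nstab] := stab a; exists N => n Nn.
have [w] := Nstab n.+1 (leqW Nn); rewrite prodE => wE.
exists (w * a N).
by rewrite -[LHS]prodE big_nat_recr //= wE mulrA.
Qed.

Lemma DCC_of_chains_stable (R : nzRingType) :
  right_chains_stable R -> DCC (RCP R).
Proof.
move=> stab f f_le.
have /choice[ab abP] : forall n, exists ab : R * R,
    exists h : right_coprime ab.1 ab.2, f n = rcp h.
  by move=> n; have [a [b [h ->]]] := rcpP (f n); exists (a, b), h.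
have f_sub n : (exists c, (ab n.+1).1 = (ab n).1 * c) /\
               (exists c, (ab n.+1).2 = (ab n).2 * c).
  have := f_le n; have [h ->] := abP n; have [h' ->] := abP n.+1.
  by move=> /rcp_leE[/rprincipal_subP ? /rprincipal_subP ?].
have S1 n := (f_sub n).1; have S2 n := (f_sub n).2.
have [N1 N1P] := right_chain_stable stab S1.
have [N2 N2P] := right_chain_stable stab S2.
have stab_max x N M n : (forall n, exists c, x n.+1 = x n * c :> R) ->
    (forall n, (N <= n)%N -> exists w, x N = x n * w) ->
    (N <= M)%N -> (M <= n)%N -> exists w, x M = x n * w.
  move=> xS xN NM Mn; have [w xw] := xN n (leq_trans NM Mn).
  have [c ->] := right_chain_le xS NM.
  by exists (w * c); rewrite mulrA -xw.
exists (maxn N1 N2) => n Nn.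
have [h ->] := abP n; have [h' ->] := abP (maxn N1 N2).
apply/rcp_eqE; split; apply/rprincipal_eqP; split.
- exact: (right_chain_le S1).
- exact: (stab_max _ _ _ _ S1 N1P (leq_maxl _ _)).
- exact: (right_chain_le S2).
- exact: (stab_max _ _ _ _ S2 N2P (leq_maxr _ _)).
Qed.

(** Brauer's lemma. Let bS be a minimal right ideal inside aS with b x b nonzero, and put c = b x.
    Then b = c b w, and u = b w x satisfies c u = c. If u u - u were nonzero it would generate bS,
    yet c kills it from the left while c b is nonzero. *)
Lemma semiprime_min_idempotent (S : nzRingType) (a : S) : right_min S ->
  (forall s : S, (forall r, s * r * s = 0) -> s = 0) -> a <> 0 ->
  exists t, a * t * (a * t) = a * t /\ a * t <> 0.
Proof.
move=> minS semiprime a0.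
have [|b [[b0 [t bE]] bmin]] := minS [set x | x <> 0 /\ exists t, x = a * t] a.
  by split=> //; exists 1; rewrite mulr1.
have {}bmin z : b * z <> 0 -> exists w, b = b * z * w.
  by move=> bz; apply: bmin; split=> //; exists (t * z); rewrite mulrA -bE.
have [x bxb] : exists x, b * x * b <> 0.
  apply: contrapT => nx; apply/b0/semiprime => x.
  by apply: contrapT => bxb; apply: nx; exists x.
pose c := b * x; have [w bw] : exists w, b = c * b * w.
  by rewrite -[c * b]mulrA; apply: bmin; rewrite mulrA.
pose v := w * x; have cu : c * (b * v) = c.
  by rewrite {2}/c {2}bw !mulrA.
have uu : b * v * (b * v) = b * v.
  apply: contrapT => nuu; pose z := v * (b * v) - v.
  have bz : b * z = b * v * (b * v) - b * v by rewrite mulrBr !mulrA.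
  have [|w' bw'] := bmin z; first by rewrite bz => /subr0_eq/nuu.
  apply: bxb; rewrite -/c bw' bz mulrA mulrBr (mulrA c) cu.
  by rewrite cu subrr mul0r.
exists (t * v); have -> : a * (t * v) = b * v by rewrite mulrA -bE.
rewrite uu; split=> // u0.
by apply: bxb; rewrite -/c -cu u0 mulr0 mul0r.
Qed.

(** Take an idempotent e in aS with y = (1 - e) a minimal. If y is nonzero, yS contains a nonzero
    idempotent f with e f = 0, and passing to e + f (1 - e) turns y into (1 - f) y; minimality gives
    f y = 0, hence f = 0. So y = 0 and a = e a. *)
Lemma semiprime_min_regular (S : nzRingType) (a : S) : right_min S ->
  (forall s : S, (forall r, s * r * s = 0) -> s = 0) -> regular_elt a.
Proof.
move=> minS semiprime.
have [|y [[e [t [ee et yE]]] ymin]] := minS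
  [set y | exists e t, [/\ e * e = e, e = a * t & y = (1 - e) * a]] a.
  by exists 0, 0; rewrite !mulr0 subr0 mul1r.
have [y0|y0] := pselect (y = 0).
  exists t; rewrite -et; apply/subr0_eq/eqP.
  by rewrite -opprB oppr_eq0 -[X in X - _]mul1r -mulrBl -yE y0.
have [s [ff f0]] := semiprime_min_idempotent minS semiprime y0.
set f := y * s in ff f0.
have ef : e * f = 0 by rewrite mulrA yE mulrA idempotent_mulNr // !mul0r.
pose f' := f * (1 - e).
have ef' : e * f' = 0 by rewrite mulrA ef mul0r.
have f'e : f' * e = 0 by rewrite -mulrA idempotent_mulNl // mulr0.
have f'f' : f' * f' = f'.
  by rewrite /f' mulrA -(mulrA f) [(1 - e) * f]mulrBl mul1r ef subr0 ff.
have f'a : f' * a = f * y by rewrite -mulrA -yE.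
have [|w yw] := ymin (1 - s * y).
  exists (e + f'), (t + (1 - t * a) * s * (1 - e)); split.
  - by rewrite mulrDl !mulrDr ee ef' f'e f'f' addr0 add0r.
  - have eC : (1 - e) * a = a * (1 - t * a).
      by rewrite mulrBl mul1r mulrBr mulr1 mulrA -et.
    by rewrite mulrDr -et /f' /f yE eC !mulrA.
  - by rewrite mulrBr mulr1 opprD addrA [RHS]mulrBl f'a -yE /f mulrA.
have {}yw : y = (y - f * y) * w by rewrite {1}yw mulrBr mulr1 mulrA.
have fy : f * y = 0.
  by rewrite [X in f * X]yw mulrA mulrBr (mulrA f f) ff subrr mul0r.
by case: f0; rewrite -ff {2}/f mulrA fy mul0r.
Qed.

(** An idempotent e of L with 1 - e minimal satisfies x e = x on L: regularity of z = x - x e yields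
    an idempotent g in L orthogonal to e, and minimality against e + g forces z = 0. The left
    annihilator of e then complements L. *)
Lemma regular_min_semisimple (S : nzRingType) : right_min S ->
  (forall a : S, regular_elt a) -> semisimple S^o.
Proof.
move=> minS reg L sL.
have LM s x : L x -> L (s * x) by apply: (@submoduleZ _ S^o).
have [|y [[e [ee Le yE]] ymin]] := minS
  [set y | exists e, [/\ e * e = e, L e & y = 1 - e]] 1.
  by exists 0; rewrite mulr0 subr0; split=> //; apply: (submodule0 sL).
have Lid x : L x -> x * e = x.
  move=> Lx; apply/esym/subr0_eq; set z := x - x * e.
  have Lz : L z by apply: (@submoduleB _ S^o) => //; apply: LM.
  have ze : z * e = 0 by rewrite mulrBl -mulrA ee subrr.
  have [w zwz] := reg z.
  have eN : (1 - e) * e = 0 by apply: idempotent_mulNl.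
  have z1e : z * (1 - e) = z by rewrite mulrBr mulr1 ze subr0.
  pose g := (1 - e) * w * z.
  have eg : e * g = 0 by rewrite !mulrA idempotent_mulNr // !mul0r.
  have ge : g * e = 0 by rewrite -mulrA ze mulr0.
  have gg : g * g = g.
    rewrite /g !mulrA -[_ * z * (1 - e)]mulrA z1e -!mulrA [z * (w * z)]mulrA.
    by rewrite zwz.
  have [|v yv] := ymin (1 - w * z).
    exists (e + g); split.
    - by rewrite mulrDl !mulrDr ee eg ge gg addr0 add0r.
    - by apply: (@submoduleD _ S^o) => //; apply: LM.
    - by rewrite mulrBr mulr1 yE opprD addrA mulrA.
  rewrite -z1e -yE yv !mulrA yE z1e mulrBr mulr1 mulrA zwz subrr.
  by rewrite mul0r.
exists [set x | x * e = 0]; split.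
  apply/submoduleP; split; first exact: mul0r.
  by move=> s u v ue ve; rewrite /= mulrDl -mulrA ue ve mulr0 addr0.
apply: direct_sum2P => //.
- apply/submoduleP; split; first exact: mul0r.
  by move=> s u v ue ve; rewrite /= mulrDl -mulrA ue ve mulr0 addr0.
- by move=> x /Lid xe; rewrite /= xe.
- move=> x; exists (x * e), (x - x * e); split; first exact: LM.
    by rewrite /= mulrBl -mulrA ee subrr.
  by rewrite addrC subrK.
Qed.

(** A minimal partial product x satisfies x = x a_n w with 1 - a_n w invertible, so x = 0: this is
    T-nilpotence. The minimum condition passes to the quotient by the radical, which is semiprime,
    hence regular, hence semisimple. *)
Lemma right_min_left_perfect (R : nzRingType) : right_min R -> left_perfect R.
Proof.
move=> minR; split; last first.
  move=> a Ja; have [|x [[n xE] xmin]] := minR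
    [set x | exists n, x = \prod_(0 <= i < n) a i] 1.
    by exists 0; rewrite big_geq.
  exists n; rewrite -xE.
  have [|w xw] := xmin (a n).
    by exists n.+1; rewrite big_nat_recr //= -xE.
  have [y [_ yE]] := jacobson_inv (jacobsonMr w (Ja n)).
  by rewrite -[x]mulr1 -yE mulrA mulrBr mulr1 mulrA -xw subrr mul0r.
have [S [f [fT fJ]]] := jacobson_quotient R.
have f_surj s : exists x, f x = s.
  by have : setT s by []; rewrite -fT => -[x _]; exists x.
exists S, f; split=> //; first by apply/seteqP; split=> x Jx; apply/fJ.
have minS : right_min S.
  move=> P s Ps; have [x0 x0E] := f_surj s.
  have [|x [Px xmin]] := minR [set x | P (f x)] x0; first by rewrite /= x0E.
  exists (f x); split=> // z; have [z' <-] := f_surj z.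
  rewrite -rmorphM => /xmin[w xw]; exists (f w).
  by rewrite -rmorphM -xw.
apply: regular_min_semisimple => // s; apply: semiprime_min_regular => // {}s.
have [x <-] := f_surj s => xx; apply/fJ; apply: jacobson_semiprime => r.
by apply/fJ; rewrite !rmorphM; apply: xx.
Qed.

(** * From left perfect rings to chain conditions *)

Section SocleSeries.
Variable S : nzRingType.
Implicit Types (A B L : set S^o) (s t x y z : S) (ts : seq S).

(** The left ideal St is simple or zero. *)
Definition simple_elt t := forall s, s * t <> 0 -> exists s', s' * (s * t) = t.

Fixpoint lspan ts : set S^o :=
  if ts is t :: ts' then [set y | exists x z, lspan ts' z /\ y = x * t + z]
  else [set 0].

Lemma submodule_lspan ts : submodule (lspan ts).
Proof.
elim: ts => [|t ts IH] /=; apply/submoduleP; split=> //.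
- by move=> s u v -> ->; rewrite scaler0 addr0.
- by exists 0, 0; rewrite mul0r addr0; split=> //; apply: (@submodule0 _ S^o).
- move=> s _ _ [x [z [zts ->]]] [x' [z' [zts' ->]]].
  exists (s * x + x'), (s * z + z'); split.
    by apply: (@submoduleD _ S^o) => //; apply: (@submoduleZ _ S^o).
  by rewrite mulrDl -mulrA addrACA -mulrDr.
Qed.

Lemma lspan_cat ts ts' y y' :
  lspan ts y -> lspan ts' y' -> lspan (ts ++ ts') (y + y').
Proof.
elim: ts y => [|t ts IH] y /=; first by move=> ->; rewrite add0r.
move=> [x [z [zts ->]]] y'ts; exists x, (z + y'); rewrite addrA.
by split=> //; apply: IH.
Qed.

(** Otherwise the socle lies in a maximal left ideal M. The component t of 1 in a complement of M is
    a simple element, so it lies in M and vanishes, which puts 1 in M. *)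
Lemma semisimple_socle : semisimple S^o ->
  exists ts, (forall t, t \in ts -> simple_elt t) /\ lspan ts 1.
Proof.
move=> ss; pose Soc : set S^o :=
  [set x | exists ts, (forall t, t \in ts -> simple_elt t) /\ lspan ts x].
apply: contrapT => nSoc1.
have [||M [maxM SocM]] := @exists_maximal_submodule S Soc; last 1 first.
- have [sM _ _] := maxM; have [T [sT MT]] := ss M sM.
  have [[m t] [[/= Mm Tt E] _]] := MT (1 : S).
  have MT0 x : M x -> T x -> x = 0.
    exact: (@direct_sum2_capE _ S^o M T x sM sT MT).
  have t_simple : simple_elt t.
    move=> s st0; have Tst : T (s * t) by apply: (@submoduleZ _ S^o).
    have [|m' [s' [Mm' E']]] := @maximal_submodule_add _ _ (s * t) maxM.
      by move=> Mst; apply/st0/MT0.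
    exists (t * s'); apply/esym/subr0_eq/MT0.
      have -> : t - t * s' * (s * t) = t * m'.
        by rewrite -[X in X - _]mulr1 E' mulrDr (mulrA t s') addrK.
      exact: (@submoduleZ _ S^o).
    by apply: (@submoduleB _ S^o) => //; apply: (@submoduleZ _ S^o).
  have Mt : M t.
    apply: SocM; exists [:: t]; split.
      by move=> u; rewrite inE => /eqP ->.
    by exists 1, 0; rewrite mul1r addr0.
  by apply: (maximal_submodule_not1 maxM); rewrite E (MT0 t) // addr0.
- apply/submoduleP; split; first by exists [::].
  move=> s u v [ts [tsS uts]] [ts' [tsS' vts]]; exists (ts ++ ts'); split.
    by move=> t; rewrite mem_cat => /orP[/tsS|/tsS'].
  apply: lspan_cat => //; apply: (@submoduleZ _ S^o); rewrite //.
  exact: submodule_lspan.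
- by [].
Qed.

(* The number of indices k at which A meets L_(k+1) outside L_k, where L_k is
   spanned by the last k entries of ts: a stand-in for the length of A when the
   entries of ts are simple. *)
Fixpoint jumps ts A : nat :=
  if ts is t :: ts' then
    (`[< exists y, [/\ A y, lspan ts y & ~ lspan ts' y] >] + jumps ts' A)%N
  else 0%N.

Lemma jumps_size ts A : (jumps ts A <= size ts)%N.
Proof. by elim: ts => //= t ts IH; case: asbool => //; apply: leqW. Qed.

Lemma jumps_sub ts A B : A `<=` B -> (jumps ts A <= jumps ts B)%N.
Proof.
move=> AB; elim: ts => //= t ts IH; apply: leq_add => //.
case: asboolP => // -[y [Ay yts yts']]; case: asboolP => // nB.
by case: nB; exists y; split=> //; apply: AB.
Qed.

(** Equal counts force the jumps of [A] and [B] to occur at the same indices. At a jump, simplicity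
    of t provides a multiple of some a in [A] whose subtraction brings a given y in [B] down to the
    next span. *)
Lemma jumps_inj ts A B : submodule A -> submodule B ->
  (forall t, t \in ts -> simple_elt t) -> A `<=` B -> jumps ts A = jumps ts B ->
  forall y, lspan ts y -> B y -> A y.
Proof.
move=> sA sB tsS AB; elim: ts tsS => [|t ts IH] tsS.
  by move=> _ y -> _; apply: (@submodule0 _ S^o).
rewrite [jumps _ A]/= [jumps _ B]/=.
have t_simple : simple_elt t by apply: tsS; rewrite mem_head.
have {}IH := IH (fun u uts => tsS u (mem_behead (s := t :: ts) uts)).
have := jumps_sub ts AB.
case: asboolP => [[a [Aa [x [z [zts aE]]] nats]]|nA].
  have -> /= : `[< exists y, [/\ B y, lspan (t :: ts) y & ~ lspan ts y] >].
    by apply/asboolP; exists a; split=> //; [apply: AB | exists x, z].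
  move=> _ [/IH {}IH] y [x2 [z2 [z2ts yE]]] By.
  have [|x' x'E] := t_simple x.
    by move=> xt0; apply: nats; rewrite aE xt0 add0r.
  have sts := submodule_lspan ts.
  have E : y - x2 * x' * a = z2 - x2 * x' * z.
    rewrite yE aE mulrDr -{1}x'E !mulrA opprD addrACA subrr add0r.
    by [].
  rewrite -(subrK (x2 * x' * a) y); apply: (@submoduleD _ S^o) => //.
    apply: IH; last first.
      apply: (@submoduleB _ S^o) => //; apply: (@submoduleZ _ S^o) => //.
      exact: AB.
    rewrite E; apply: (@submoduleB _ S^o) => //.
    exact: (@submoduleZ _ S^o).
  exact: (@submoduleZ _ S^o).
case: asboolP => [_ /= le eq|nB _ /IH {}IH].
  by move: le; rewrite -ltnS -[X in (_ < X)%N]add1n -eq ltnn.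
move=> y yts By; have [yts'|nyts] := pselect (lspan ts y); first exact: IH.
by case: nB; exists y.
Qed.

Local Notation p b m n := (\prod_(m <= i < n) b i).

(* The maps S -> S of right multiplication by the b m form a direct system of
   modules of length at most that of S; for fixed n, the left ideals A m n are
   the inverse images in stage n of the images of stage m in the direct limit.
   They grow strictly at every m where b m has no left inverse on the limit. *)
Lemma semisimple_left_inverses (b : nat -> S) : semisimple S^o ->
  exists m0, forall m, (m0 <= m)%N ->
    exists r n, (m < n)%N /\ (1 - r * b m) * p b m.+1 n = 0.
Proof.
move=> /semisimple_socle[ts [tsS ts1]]; apply: contrapT => nm0.
(* The kernel of the map from stage n to the direct limit. *)
pose L n : set S^o := [set s | exists k, (n <= k)%N /\ s * p b n k = 0].
have L_le n k k' s : (n <= k)%N -> (k <= k')%N -> s * p b n k = 0 ->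
    s * p b n k' = 0.
  by move=> nk kk' E; rewrite (big_cat_nat nk kk') mulrA /= E mul0r.
have sL n : submodule (L n).
  apply/submoduleP; split; first by exists n; rewrite mul0r.
  move=> s u v [k [nk uk]] [k' [nk' vk']]; exists (maxn k k').
  rewrite (leq_trans nk (leq_maxl _ _)); split=> //.
  rewrite mulrDl -[s *: u]/(s * u) -mulrA.
  rewrite (L_le _ _ _ _ nk (leq_maxl k k') uk).
  by rewrite (L_le _ _ _ _ nk' (leq_maxr k k') vk') mulr0 addr0.
pose A m n : set S^o := [set s | exists x, L n (s - x * p b m n)].
have sA m n : submodule (A m n).
  apply/submoduleP; split.
    by exists 0; rewrite mul0r subr0; apply: (@submodule0 _ S^o).
  move=> s u v [x xL] [y yL]; exists (s * x + y).
  have -> : s *: u + v - (s * x + y) * p b m n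
      = s *: (u - x * p b m n) + (v - y * p b m n).
    by rewrite scalerBr mulrDl opprD addrACA -mulrA.
  by apply: (@submoduleD _ S^o) => //; apply: (@submoduleZ _ S^o).
have A_sub m n : (m < n)%N -> A m n `<=` A m.+1 n.
  by move=> mn s [x xL]; exists (x * b m); rewrite -mulrA -big_ltn.
have A_sub_le m m' n : (m <= m')%N -> (m' <= n)%N -> A m n `<=` A m' n.
  move=> /subnKC <-; elim: (m' - m)%N => [|d IH]; first by rewrite addn0 => _ s.
  rewrite addnS => dn; apply: (subset_trans (IH (ltnW dn))).
  exact: A_sub.
have large k : exists m, forall n, (m <= n)%N -> (k <= jumps ts (A m n))%N.
  elim: k => [|k [m IH]]; first by exists 0%N.
  have [m' [mm' ninv]] : exists m', (m <= m')%N /\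
      ~ exists r n, (m' < n)%N /\ (1 - r * b m') * p b m'.+1 n = 0.
    apply: contrapT => nm'; apply: nm0; exists m => m' mm'.
    by apply: contrapT => ninv; apply: nm'; exists m'.
  exists m'.+1 => n m'n; have mn := leq_trans mm' (ltnW m'n).
  apply: leq_ltn_trans (IH n mn) _.
  apply: leq_ltn_trans (jumps_sub ts (A_sub_le _ _ _ mm' (ltnW m'n))) _.
  rewrite ltn_neqAle (jumps_sub ts (A_sub _ _ m'n)) andbT.
  apply/eqP => /(jumps_inj (sA _ _) (sA _ _) tsS (A_sub _ _ m'n)) AA.
  (* The element tested is the image in stage n of 1 at stage m' + 1; if in the limit it comes from
     x at stage m', then x is a left inverse of b m' there. *)
  have [||x [k' [nk' E]]] := AA (p b m'.+1 n).
  - rewrite -[X in lspan _ X]mulr1; apply: (@submoduleZ _ S^o) => //.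
    exact: submodule_lspan.
  - by exists 1; rewrite mul1r subrr; apply: (@submodule0 _ S^o).
  apply: ninv; exists x, k'; split; first exact: leq_trans m'n nk'.
  rewrite (big_cat_nat m'n nk') /= mulrA -E; congr (_ * _).
  by rewrite mulrBl mul1r -mulrA -big_ltn.
have [m mP] := large (size ts).+1.
by have := leq_trans (mP m (leqnn m)) (jumps_size ts _); rewrite ltnn.
Qed.

End SocleSeries.

(* One Newton step towards an idempotent, carried out in Z[X] and evaluated
   at g: with c = g - g^2, replacing g by g + c(2g - 1) = 3g^2 - 2g^3 replaces
   c by c^2(3 + 4c). *)
Lemma idempotent_newton (R : nzRingType) (g : R) : exists g' y z,
  [/\ g' - g = (g - g * g) * y,
      g' - g' * g' = (g - g * g) * (g - g * g) * z &
      GRing.comm (g - g * g) z].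
Proof.
pose phi : {rmorphism {poly int} -> R} :=
  horner_morph (fun x : int => commr_int g x).
have phiX : phi 'X = g by apply: horner_morphX.
pose C : {poly int} := 'X - 'X * 'X.
pose Q := 'X + C * ('X + 'X - 1).
have phiC : phi C = g - g * g by rewrite rmorphB rmorphM /= phiX.
exists (phi Q), (phi ('X + 'X - 1)), (phi (1 + 1 + 1 + (C + C + C + C))).
rewrite -phiC; split.
- by rewrite -{1}phiX -rmorphB -rmorphM; congr (phi _); rewrite /Q addrC addKr.
- by rewrite -!rmorphM -rmorphB; congr (phi _); rewrite /Q /C; ring.
- by rewrite /GRing.comm -!rmorphM mulrC.
Qed.

(** Each Newton step changes g by an element of [J] and halves the exponent in (g - g g)^(2^n) =
    0. *)
Lemma nil_idempotent_lift (R : nzRingType) (J : set R) (g : R) :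
  (forall x y, J x -> J (x * y)) -> (forall x y, J x -> J y -> J (x + y)) ->
  (forall x, J x -> exists n, x ^+ n = 0) -> J (g - g * g) ->
  exists e, e * e = e /\ J (e - g).
Proof.
move=> JM JD Jnil Jg.
have : exists n, (g - g * g) ^+ (2 ^ n) = 0.
  have [n gn] := Jnil _ Jg; exists n.
  by rewrite -(subnKC (ltnW (ltn_expl n (ltnSn 1)))) exprD gn mul0r.
move=> [n]; elim: n g Jg => [|n IH] g Jg.
  rewrite expr1 => g0; exists g; split; first exact/esym/subr0_eq.
  by rewrite subrr -g0.
rewrite expnS exprM expr2 => gn.
have [g' [y [z [g'g g'z cz]]]] := idempotent_newton g.
have [|| e [ee eg']] := IH g'.
- by rewrite g'z; exact: JM (JM _ _ Jg).
- rewrite g'z exprMn_comm ?gn ?mul0r //.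
  by apply: commr_sym; apply: commrM; apply: commr_sym.
exists e; split=> //; rewrite -(subrK g' e) -addrA.
by apply: JD => //; rewrite g'g; apply: JM.
Qed.

(** * Idempotents along the direct system, and stable chains *)

Section ChainStability.
Variables (R : nzRingType) (a : nat -> R).
Implicit Types (x y l r g c : R) (m n k : nat).

Local Notation J := (@jacobson_radical R).
Local Notation p m n := (\prod_(m <= i < n) a i).

(* The left ideal of all l killing, modulo J, the image of 1 at stage m of the
   direct system R -> R -> ... of right multiplications by a m, a m.+1, ... *)
Definition stage_ker m : set R :=
  [set l | exists n, (m <= n)%N /\ J (l * p m n)].

Lemma stage_ker_le m n l : stage_ker m l ->
  exists k, (n <= k)%N /\ (m <= k)%N /\ J (l * p m k).
Proof.
move=> [k [mk Jk]]; exists (maxn n k); rewrite leq_maxl.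
have nk := leq_maxr n k; rewrite (leq_trans mk nk); split=> //; split=> //.
by rewrite (big_cat_nat mk nk) /= mulrA; apply: jacobsonMr.
Qed.

Lemma stage_kerJ m l : J l -> stage_ker m l.
Proof. by move=> Jl; exists m; rewrite big_geq // mulr1. Qed.

Lemma stage_kerM m r l : stage_ker m l -> stage_ker m (r * l).
Proof.
by move=> [n [mn Jn]]; exists n; rewrite -mulrA; split=> //; apply: jacobsonMl.
Qed.

Lemma stage_kerD m x y : stage_ker m x -> stage_ker m y -> stage_ker m (x + y).
Proof.
move=> [n [mn Jn]] /(stage_ker_le n)[k [nk [mk Jk]]]; exists k; split=> //.
rewrite mulrDl; apply: jacobsonD => //.
by rewrite (big_cat_nat mn nk) /= mulrA; apply: jacobsonMr.
Qed.

Lemma stage_kerN m x : stage_ker m x -> stage_ker m (- x).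
Proof. by rewrite -mulN1r; apply: stage_kerM. Qed.

Lemma stage_kerS m x : stage_ker m x <-> stage_ker m.+1 (x * a m).
Proof.
split=> [/(stage_ker_le m.+1)[n [mn [_ Jn]]]|[n [mn Jn]]]; exists n; split=> //.
- by rewrite -mulrA -big_ltn.
- exact: ltnW.
- by rewrite big_ltn // mulrA.
Qed.

(* The element g generates an idempotent summand Rg of R mapped isomorphically,
   modulo J, onto the image of stage m in the direct limit. *)
Definition stage_idempotent m g :=
  [/\ g * g = g, stage_ker m (1 - g) & forall l, stage_ker m l -> J (l * g)].

(* If g a_m c = g, then c g a_m is again idempotent: no further lifting modulo
   J is needed once stage 0 has been treated. *)
Lemma stage_idempotentS m g r : stage_idempotent m g ->
  stage_ker m.+1 (1 - r * a m) ->
  exists g', stage_idempotent m.+1 g' /\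
    (exists c, g * a m * c = g) /\ g * a m * (1 - g') = 0.
Proof.
move=> [gg Kg gK] Kr.
have Jg1 : J ((1 - a m * r) * g).
  apply: gK; apply/stage_kerS.
  have -> : (1 - a m * r) * a m = a m * (1 - r * a m).
    by rewrite mulrBl mulrBr mul1r mulr1 mulrA.
  exact: stage_kerM.
have Jj : J (g * (1 - a m * r) * g) by rewrite -mulrA; apply: jacobsonMl.
set j := g * _ * g in Jj.
have [u [_ uE]] := jacobson_inv Jj.
have Ju : J (u - 1).
  have -> : u - 1 = j * u.
    by rewrite -[X in _ - X]uE mulrBl mul1r opprB addrC subrK.
  exact: jacobsonMr.
(* Since g a_m r g = g (1 - j), correcting r g by the inverse u of 1 - j makes the identity
   exact. *)
have [c gac Jc] : exists2 c, g * a m * c = g & J (c - r * g).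
  exists (r * g * u); last first.
    by rewrite -[X in _ - X]mulr1 -mulrBr; apply: jacobsonMl.
  have E : g * a m * r * g = g * (1 - j).
    rewrite mulrBr mulr1 /j !mulrA gg mulrBr mulr1 mulrBl gg.
    by rewrite opprB addrC subrK !mulrA.
  by rewrite !mulrA E -mulrA uE mulr1.
exists (c * g * a m); split; last first.
  split; first by exists c.
  by rewrite mulrBr mulr1 !mulrA gac gg subrr.
split.
- have -> : c * g * a m * (c * g * a m) = c * (g * a m * c) * g * a m.
    by rewrite !mulrA.
  by rewrite gac -(mulrA c) gg.
- have -> : 1 - c * g * a m = (1 - r * a m) + (r * ((1 - g) * a m)
      - (c - r * g) * g * a m).
    have -> : r * ((1 - g) * a m) = r * a m - r * g * a m.
      by rewrite mulrBl mul1r mulrBr !mulrA.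
    have -> : (c - r * g) * g * a m = c * g * a m - r * g * a m.
      by rewrite mulrBl -(mulrA r g g) gg mulrBl.
    by rewrite opprB [X in _ = _ + X]addrA subrK addrA subrK.
  apply: stage_kerD => //; apply: stage_kerD.
    by apply: stage_kerM; apply: (stage_kerS _ _).1.
  by apply: stage_kerJ; apply: jacobsonN; do 2!apply: jacobsonMr.
- move=> l Kl; rewrite !mulrA; apply: jacobsonMr.
  have -> : l * c * g = l * r * g + l * (c - r * g) * g.
    by rewrite mulrBr mulrBl -!mulrA gg addrC subrK.
  apply: jacobsonD; last by apply: jacobsonMr; apply: jacobsonMl.
  apply: gK; apply/stage_kerS.
  have -> : l * r * a m = l - l * (1 - r * a m).
    by rewrite mulrBr mulr1 opprB addrC subrK mulrA.
  by apply: stage_kerD => //; apply: stage_kerN; apply: stage_kerM.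
Qed.

(* Relative to the idempotents G n, the maps a n are triangular with an
   invertible corner at G, and, after regrouping the a n along nn, the opposite
   corners z k lie in J: T-nilpotence kills a product of the z k, and from then
   on the chain is carried by the invertible corners. *)
Lemma stage_idempotent_stable g : left_T_nilpotent J ->
  stage_idempotent 0 g ->
  (forall m, exists r, stage_ker m.+1 (1 - r * a m)) ->
  exists N, forall n, (N <= n)%N -> exists w, p 0 N = p 0 n * w.
Proof.
move=> Tnil g0P inv.
have step m h : exists h', stage_idempotent m h ->
    stage_idempotent m.+1 h' /\
    (exists c, h * a m * c = h) /\ h * a m * (1 - h') = 0.
  have [hP|nhP] := pselect (stage_idempotent m h); last by exists 0.
  have [r rP] := inv m; have [h' h'P] := stage_idempotentS hP rP.
  by exists h'.
have /choice[F FP] : forall mh : nat * R, exists h',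
    stage_idempotent mh.1 mh.2 -> stage_idempotent mh.1.+1 h' /\
    (exists c, mh.2 * a mh.1 * c = mh.2) /\ mh.2 * a mh.1 * (1 - h') = 0.
  by move=> [m h]; apply: step.
have [G [G0 GE]] : exists G : nat -> R,
    G 0%N = g /\ forall n, G n.+1 = F (n, G n).
  by exists (fix G n := if n is k.+1 then F (k, G k) else g).
have GP n : stage_idempotent n (G n).
  by elim: n => [|n IH]; rewrite ?G0 // GE; have [] := FP (n, G n) IH.
have GS n : (exists c, G n * a n * c = G n) /\ G n * a n * (1 - G n.+1) = 0.
  by rewrite GE; have [] := FP (n, G n) (GP n).
have G1 m n : (m <= n)%N -> G m * p m n * (1 - G n) = 0.
  move=> /subnKC <-; elim: (n - m)%N => [|d IH].
    by rewrite addn0 big_geq // mulr1 idempotent_mulNr //; have [] := GP m.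
  rewrite addnS big_nat_recr ?leq_addr //=.
  have E : G m * p m (m + d)%N = G m * p m (m + d)%N * G (m + d)%N.
    by apply/subr0_eq; rewrite -[X in X - _]mulr1 -mulrBr IH.
  rewrite mulrA E -[X in X * (1 - _)]mulrA -(mulrA (G m * p m (m + d)%N)).
  by rewrite (GS _).2 mulr0.
(* By stage nx m the complement 1 - G m has been carried into the radical. *)
have /choice[nx nxP] : forall m, exists n, (m < n)%N /\ J ((1 - G m) * p m n).
  move=> m; have [_ /(stage_ker_le m.+1)[n [mn [_ Jn]]] _] := GP m.
  by exists n.
have [nn [nn0 nnE]] : exists nn : nat -> nat,
    nn 0%N = 0%N /\ forall k, nn k.+1 = nx (nn k).
  by exists (fun k => iter k nx 0%N).
have nnS k : (nn k < nn k.+1)%N by rewrite nnE; have [] := nxP (nn k).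
pose z k := p (nn k) (nn k.+1) * (1 - G (nn k.+1)).
have Jz k : J (z k).
  have -> : z k = (1 - G (nn k)) * p (nn k) (nn k.+1) * (1 - G (nn k.+1)).
    by rewrite !mulrBl mul1r G1 ?subr0 // ltnW.
  by apply: jacobsonMr; rewrite nnE; have [] := nxP (nn k).
have zE k : \prod_(0 <= i < k.+1) z i = p 0 (nn k.+1) * (1 - G (nn k.+1)).
  elim: k => [|k IH]; first by rewrite big_nat1 /z nn0.
  rewrite big_nat_recr //= IH /z (big_cat_nat (leq0n _) (ltnW (nnS k.+1))) /=.
  rewrite -!mulrA; congr (_ * _).
  by rewrite mulrBl mul1r mulrA G1 ?subr0 // ltnW.
have [k zk] := Tnil z Jz.
have pN : p 0 (nn k.+1) * (1 - G (nn k.+1)) = 0.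
  by rewrite -zE big_nat_recr //= zk mul0r.
exists (nn k.+1) => n /subnKC <-.
(* From this stage on p 0 n = p 0 n G n; a c with G n a_n c = G n then gives p 0 n = p 0 (n + 1) c,
   so the right ideals no longer shrink. *)
have pG d : let n := (nn k.+1 + d)%N in p 0 n = p 0 n * G n.
  elim: d => [|d IH] /=.
    by apply/subr0_eq; rewrite addn0 -[X in X - _]mulr1 -mulrBr.
  rewrite addnS big_nat_recr //= IH; apply/subr0_eq.
  rewrite -[X in X - _]mulr1 -mulrBr -!mulrA [G _ * (_ * _)]mulrA (GS _).2.
  by rewrite mulr0.
elim: (n - _)%N => [|d [w wE]]; first by exists 1; rewrite addn0 mulr1.
have [c cE] := (GS (nn k.+1 + d)%N).1.
by exists (c * w); rewrite wE addnS big_nat_recr //= pG -{1}cE !mulrA.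
Qed.

End ChainStability.

(** Past the first [m0] factors, every map has a left inverse on the limit modulo the radical. The
    kernel at stage 0 is complemented in the semisimple quotient, and the resulting idempotent is
    lifted to start the propagation. *)
Lemma left_perfect_chains_stable (R : nzRingType) :
  left_perfect R -> right_chains_stable R.
Proof.
move=> [[S [f [fT fJ ss]]] Tnil] a.
have fJP (x : R) : f x = 0 <-> jacobson_radical x.
  by split=> [f0|Jx]; [rewrite -fJ | have : (f @^-1` [set 0]) x by rewrite fJ].
have f_surj s : exists x, f x = s.
  by have : setT s by []; rewrite -fT => -[x _]; exists x.
have [m0 m0P] := semisimple_left_inverses (fun i => f (a i)) ss.
pose b i := a (m0 + i)%N.
have inv m : exists r, stage_ker b m.+1 (1 - r * b m).
  have [s [n [mn E]]] := m0P (m0 + m)%N (leq_addr _ _).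
  have [r rE] := f_surj s; exists r, (n - m0)%N; split.
    by rewrite ltn_subRL.
  apply/fJP; rewrite rmorphM rmorphB rmorph1 rmorphM rE rmorph_prod.
  rewrite -[RHS]E; congr (_ * _).
  rewrite -addnS -[X in _ = \prod_(_ <= i < X) _](subnK (m := m0) (n := n)).
    rewrite [(m0 + _)%N]addnC big_addn addnK.
    by apply: eq_bigr => i _; rewrite /b addnC.
  by rewrite (leq_trans (leq_addr m m0)) // ltnW.
have Jnil (x : R) : jacobson_radical x -> exists n, x ^+ n = 0.
  move=> Jx; have [n xn] := Tnil (fun=> x) (fun=> Jx); exists n.
  by rewrite -xn big_const_nat subn0 -Monoid.iteropE.
have [g gP] : exists g, stage_idempotent b 0 g.
  pose K : set S^o := [set s | exists l, stage_ker b 0 l /\ f l = s].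
  have sK : submodule K.
    apply/submoduleP; split.
      exists 0; rewrite rmorph0; split=> //.
      by apply: stage_kerJ; apply: jacobson0.
    move=> s _ _ [l [Kl <-]] [l' [Kl' <-]]; have [r <-] := f_surj s.
    exists (r * l + l'); rewrite rmorphD rmorphM; split=> //.
    by apply: stage_kerD => //; apply: stage_kerM.
  have [B [sB KB]] := ss K sK.
  (* For x in [K], x e = x - x k lies in both [K] and [B], so [K] e = 0; as 1 - e = k lies in [K], e
     is idempotent. *)
  have [[k e] [[/= [l [Kl lk]] Be E] _]] := KB (1 : S).
  have Ke x : K x -> x * e = 0.
    move=> Kx; apply: (@direct_sum2_capE _ S^o K B _ sK sB KB).
      have -> : x * e = x - x * k.
        by rewrite -[X in X - _]mulr1 E mulrDr addrC addKr.
      apply: (@submoduleB _ S^o) => //; apply: (@submoduleZ _ S^o) => //.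
      by exists l.
    exact: (@submoduleZ _ S^o).
  have [h hE] := f_surj e.
  have Kh : stage_ker b 0 (1 - h).
    rewrite -(subrK l (1 - h)); apply: stage_kerD => //.
    apply: stage_kerJ; apply/fJP.
    by rewrite !rmorphB rmorph1 hE lk E addrK subrr.
  have hK x : stage_ker b 0 x -> jacobson_radical (x * h).
    by move=> Kx; apply/fJP; rewrite rmorphM hE; apply: Ke; exists x.
  have [||||g [gg Jg]] := @nil_idempotent_lift R (@jacobson_radical R) h.
  - by move=> x y; apply: jacobsonMr.
  - by move=> x y; apply: jacobsonD.
  - exact: Jnil.
  - by rewrite -[X in X - _]mul1r -mulrBl; apply: hK.
  exists g; split=> // [|x Kx].
    have -> : 1 - g = (1 - h) - (g - h) by rewrite opprB addrA subrK.
    by apply: stage_kerD => //; apply: stage_kerN; apply: stage_kerJ.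
  have -> : x * g = x * h + x * (g - h) by rewrite mulrBr addrC subrK.
  by apply: jacobsonD; [apply: hK | apply: jacobsonMl].
have [N Nstab] := stage_idempotent_stable Tnil gP inv.
have prodE n : \prod_(0 <= i < m0 + n) a i =
    \prod_(0 <= i < m0) a i * \prod_(0 <= i < n) b i.
  rewrite (big_cat_nat (leq0n m0) (leq_addr n m0)) /=; congr (_ * _).
  rewrite -{1}[m0]add0n big_addn addKn.
  by apply: eq_bigr => i _; rewrite /b addnC.
exists (m0 + N)%N => n Nn; have [w wE] : exists w,
    \prod_(0 <= i < N) b i = \prod_(0 <= i < n - m0) b i * w.
  by apply: Nstab; rewrite leq_subRL // (leq_trans (leq_addr N m0)).
have {1}-> : n = (m0 + (n - m0))%N.
  by rewrite subnKC // (leq_trans (leq_addr N m0)).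
by exists w; rewrite !prodE wE mulrA.
Qed.

Theorem proposition2p5 (R : nzRingType) :
  (* (1) *)
  (indecomposable R^c^o <-> exactly_two_minimal_elts (RCP R)) /\
  (* (2) *)
  ((local_ring R <-> forall p : RCP R, rcp_trivial p) /\
   (local_ring R <->
      exactly_two_minimal_elts (RCP R) /\
      forall p : RCP R, exists q : RCP R, minimal_elt q /\ (q <= p)%O)) /\
  (* (3) *)
  (left_perfect R <-> DCC (RCP R)) /\
  (* (4) *)
  (von_neumann_regular R <-> forall p : RCP R, rcp_regular p) /\
  (* (5) *)
  (exchange_ring R <->
     forall p : RCP R, exists q : RCP R, minimal_elt q /\ (q <= p)%O) /\
  (* (6) *)
  (right_quasi_duo R <->
     forall a b : R, left_coprime a b -> right_coprime a b).
Proof.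
split; first by rewrite indecomposableP exactly_two_minimal_eltsP.
split; first by rewrite local_ringP -trivial_pairsP -trivial_pairs_minimal.
split.
  split=> [/left_perfect_chains_stable/DCC_of_chains_stable //|].
  by move/DCC_right_min/right_min_left_perfect.
split; first exact: von_neumann_regularP.
split; first exact: exchange_ringP.
exact: right_quasi_duoP.
Qed.
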